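(* Let $p \equiv 7 \pmod 8$ be a prime such that the multiplicative order of $2$ modulo $p$ is $\frac{p-1}{2}$. Then there is no generalized bent function from $\mathbb{Z}_2^n$ to $\mathbb{Z}_m$ of type $[n,m] = [t_p, 2p]$. If moreover $2^{p-1} \not\equiv 1 \pmod{p^2}$, then for every integer $e \ge 1$ there is no generalized bent function from $\mathbb{Z}_2^n$ to $\mathbb{Z}_m$ of type $[n,m] = [t_p, 2p^e]$.
   Context: For a positive integer $m$ let $\mathbb{Z}_m = \mathbb{Z}/m\mathbb{Z}$ and $\zeta_m = \exp(2\pi i/m)$. A function $f : \mathbb{Z}_2^n \to \mathbb{Z}_m$ is a generalized bent function of type $[n,m]$ if $\left|\sum_{x \in \mathbb{Z}_2^n} \zeta_m^{f(x)} (-1)^{x\cdot\lambda}\right| = 2^{n/2}$ for every $\lambda \in \mathbb{Z}_2^n$, where $x\cdot\lambda$ is the standard dot product. For a prime $p \equiv 7 \pmod 8$, the prime $2$ splits in $\mathbb{Q}(\sqrt{-p})$; $t_p$ denotes the smallest positive integer such that $\mathfrak{p}^{t_p}$ is principal, where $\mathfrak{p}$ is a prime ideal of the ring of integers of $\mathbb{Q}(\sqrt{-p})$ lying above $2$. *)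

(* Defs.v *)
From HB Require Import structures.
From mathcomp Require Import all_boot all_order all_algebra.
From mathcomp Require Import reals trigo Rstruct.
From mathcomp Require Import complex.
Set Implicit Arguments. Unset Strict Implicit. Unset Printing Implicit Defensive.
Import Order.TTheory GRing.Theory Num.Theory.
Local Open Scope ring_scope.

Definition RR : realType := Rdefinitions.R.
Definition CC := (RR[i])%type.

Definition zeta (m : nat) : CC :=
  Complex (cos (2 * pi / m%:R) : RR) (sin (2 * pi / m%:R)).

Definition dotF2 (n : nat) (x l : 'rV['F_2]_n) : 'F_2 := (x *m l^T) 0 0.

Definition gwalsh (n m : nat) (f : 'rV['F_2]_n -> 'Z_m) (l : 'rV['F_2]_n) : CC :=
  \sum_(x : 'rV['F_2]_n) zeta m ^+ (f x : nat) * (-1) ^+ (dotF2 x l : nat).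

Definition gbent (n m : nat) (f : 'rV['F_2]_n -> 'Z_m) : Prop :=
  forall l : 'rV['F_2]_n, `| gwalsh f l | = ((Num.sqrt (2 ^+ n : RR))%:C)%C.

(** For a prime p = 7 mod 8, the ring of integers of Q(sqrt(-p)) is Z[w] with
    w = (1 + sqrt(-p))/2, w^2 = w - (p+1)/4.  An element a + b w is encoded as
    the pair (a, b) of integers. *)
Definition OK := (int * int)%type.

Definition OKadd (x y : OK) : OK := (x.1 + y.1, x.2 + y.2).
Definition OKmul (p : nat) (x y : OK) : OK :=
  let k := ((p.+1) %/ 4)%N%:Z in
  (x.1 * y.1 - k * (x.2 * y.2), x.1 * y.2 + x.2 * y.1 + x.2 * y.2).

Definition ideal_of := OK -> Prop.

Definition gen_ideal (p : nat) (S : OK -> Prop) : ideal_of :=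
  fun z => exists s : seq (OK * OK),
    (forall c, c \in s -> S c.2) /\
    z = foldr (fun c acc => OKadd (OKmul p c.1 c.2) acc) (0, 0) s.

Definition ideal_mul (p : nat) (I J : ideal_of) : ideal_of :=
  gen_ideal p (fun z => exists a b, I a /\ J b /\ z = OKmul p a b).

Definition ideal_unit (p : nat) : ideal_of := gen_ideal p (fun z => z = (1, 0)).

Fixpoint ideal_pow (p : nat) (I : ideal_of) (t : nat) : ideal_of :=
  match t with
  | 0 => ideal_unit p
  | t'.+1 => ideal_mul p I (ideal_pow p I t')
  end.

Definition principal (p : nat) (I : ideal_of) : Prop :=
  exists g : OK, forall z, I z <-> exists r : OK, z = OKmul p r g.

(** The prime ideal (2, w) of O_K lying above 2 (for p = 7 mod 8, 2 splits as
    (2, w)(2, w - 1)). *)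
Definition p2 (p : nat) : ideal_of :=
  gen_ideal p (fun z => z = (2, 0) \/ z = (0, 1)).

Definition is_tp (p t : nat) : Prop :=
  (0 < t)%N /\ principal p (ideal_pow p (p2 p) t) /\
  forall s, (0 < s < t)%N -> ~ principal p (ideal_pow p (p2 p) s).

Definition mult_order_mod (a m k : nat) : Prop :=
  (0 < k)%N /\ (a ^ k = 1 %[mod m])%N /\
  forall j, (0 < j < k)%N -> (a ^ j <> 1 %[mod m])%N.

(* Main.v *)
Require Import Defs.
From HB Require Import structures.
From mathcomp Require Import all_boot all_order all_algebra all_solvable all_field.
From mathcomp Require Import ring zify lra.
From mathcomp Require Import reals trigo Rstruct.
From mathcomp Require Import complex.
Import Order.TTheory GRing.Theory Num.Theory.
Set Implicit Arguments. Unset Strict Implicit. Unset Printing Implicit Defensive.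

(** Let m = p^e, let z be a primitive m-th root of unity and sigma : z |-> z^2.
    The values F(l) of the Walsh transform lie in Z[z] and F(l) F(l)^* = 2^t.
    Since 2 is unramified and sigma generates its decomposition group, every
    ideal of Z[z] containing a power of 2 is sigma-stable, so sigma(F)/F is a
    unit all of whose conjugates have modulus 1, hence +-z^j.  The sign is +
    because sigma has odd order, so F = z^j g with g fixed by sigma.  As 2 and
    -1 generate the units modulo m, g lies in Q(sqrt -p): g = (a + b G)/2 with
    G the quadratic Gauss sum and a^2 + p b^2 = 2^(t+2).  The minimality of
    t = t_p forces t and a to be odd and determines (a^2, b^2).  All F(l) are
    congruent modulo 2, which leaves only F(l) = +-F(0); then the sum of the
    F(l), which is 2^t times a root of unity, equals N F(0) for an integer N,
    so N^2 = 2^t, contradicting the parity of t.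

    Elements of Z[z] are represented by integer polynomials evaluated at z. *)

(** * Units modulo a prime power *)

(** No automorphism is built: irreducibility of the cyclotomic polynomial carries an equality
    between values at z over to z^k for every k prime to m. The ideals of Z[z] are likewise replaced
    by one congruence, sigma(y) in (y, 2^t) for every y. For y = F(l) the term 2^t is F(l) times its
    conjugate, hence a multiple of F(l), so F(l) divides sigma(F(l)). The condition on 2^(p-1) makes
    the order of 2 grow by a factor p from each power of p to the next, so the powers of 2 keep
    index 2 among the units; their number is odd, which keeps -1 out of them. The last obstacle is
    that the norm equation fixes F(l) only up to sign, a root of unity y and conjugation. If y
    differs from 1, then y - 1 divides the odd number m and is invertible modulo 2, so the
    congruence between the F(l) would make g even. If a conjugation occurs, the square of g is
    congruent to a multiple of 2^t, hence even. Both contradict the oddness of a = g + conj g. *)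

Lemma count_coprime n : count (fun k => coprime k n) (iota 0 n) = totient n.
Proof.
rewrite totient_count_coprime -sum1_count /index_iota subn0 big_mkcond.
by apply: eq_bigr => k _; rewrite coprime_sym; case: ifP.
Qed.

Section UnitsModPrimePower.
Variable p : nat.
Hypotheses (p_pr : prime p) (p_odd : odd p).

Let p_gt0 : 0 < p := prime_gt0 p_pr.

(** Three explicit terms suffice: for k = p odd and p dividing x, the quadratic term gains a factor
    p from the binomial coefficient and the cubic one is small enough p-adically. *)
Lemma expn_1D x k : exists r, (1 + x) ^ k = 1 + k * x + 'C(k, 2) * x ^ 2 + x ^ 3 * r.
Proof.
elim: k => [|k [r IH]]; first by exists 0; rewrite bin0n expn0; lia.
exists (r + 'C(k, 2) + x * r); rewrite expnS IH binS bin1 !expnS expn0; nia.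
Qed.

Lemma expn_1D_pfactor u k : exists v, (1 + p * u) ^ (p ^ k) = 1 + p ^ k.+1 * (u + p * v).
Proof.
elim: k => [|k [v IH]]; first by exists 0; rewrite expn1 muln0 addn0 expn1.
set u' := u + p * v in IH.
have [r Dr] := expn_1D (p ^ k.+1 * u') p.
exists (v + p ^ k * (p.-1./2 * u' ^ 2) + p ^ k * p ^ k * u' ^ 3 * r).
rewrite expnSr expnM IH Dr bin2odd // !expnS expn0 /u'; ring.
Qed.

(** Lifting: if k = p^e k', then (1 + p u)^k is 1 + p^(e+1) k' u modulo p^(e+2), so one more power
    of p in the modulus forces p to divide k'. *)
Lemma pfactor_dvd_exponent u k e : ~~ (p %| u) ->
  (1 + p * u) ^ k = 1 %[mod p ^ e.+1] -> p ^ e %| k.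
Proof.
move=> pu; elim: e => [|e IH] E; first by rewrite expn0 dvd1n.
have /dvdnP[k' Dk] : p ^ e %| k.
  apply: IH; move: E; have dv : p ^ e.+1 %| p ^ e.+2 by rewrite dvdn_exp2l.
  by rewrite -(modn_dvdm _ dv) => ->; rewrite modn_dvdm.
have [v Dv] := expn_1D_pfactor u e.
have [r Dr] := expn_1D (p ^ e.+1 * (u + p * v)) k'.
move/eqP: E; rewrite Dk [k' * _]mulnC expnM Dv Dr -!addnA.
rewrite -[X in _ == X %[mod _]]addn0 eqn_modDl mod0n.
have -> : k' * (p ^ e.+1 * (u + p * v)) +
    ('C(k', 2) * (p ^ e.+1 * (u + p * v)) ^ 2 + (p ^ e.+1 * (u + p * v)) ^ 3 * r) =
  p ^ e.+1 * (k' * u + p * (k' * v + 'C(k', 2) * p ^ e * (u + p * v) ^ 2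
     + p ^ e * p ^ e.+1 * (u + p * v) ^ 3 * r)).
  by rewrite !expnS expn0; ring.
rewrite -/(dvdn _ _) [p ^ e.+2]expnSr dvdn_pmul2l ?expn_gt0 ?p_gt0 //.
rewrite [p %| _ + _]dvdn_addl; last exact: dvdn_mulr.
rewrite Euclid_dvdM // (negbTE pu) orbF => pk'.
by rewrite [p ^ e.+1]expnSr dvdn_mul.
Qed.

Lemma order_dvd a n h j : mult_order_mod a n h -> a ^ j = 1 %[mod n] -> h %| j.
Proof.
case=> h_gt0 [ah min_h] aj; rewrite /dvdn; apply: contraPT aj => nz.
have aq : (a ^ h) ^ (j %/ h) = 1 %[mod n] by rewrite -modnXm ah modnXm exp1n.
rewrite [in X in X %% _](divn_eq j h) expnD [_ %/ _ * _]mulnC expnM -modnMml aq.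
rewrite modnMml mul1n.
by apply: min_h; rewrite lt0n nz ltn_pmod.
Qed.

Variable e : nat.
Let m := p ^ e.+1.
Let h := p.-1./2.
Let d := h * p ^ e.
Hypothesis h_odd : odd h.
Hypothesis ord2 : mult_order_mod 2 p h.
Hypothesis wieferich : e = 0 \/ 2 ^ p.-1 <> 1 %[mod p ^ 2].

Let p_gt2 : 2 < p. Proof. by move: p_odd (prime_gt1 p_pr); lia. Qed.
Let m_gt2 : 2 < m.
Proof. by rewrite (leq_trans p_gt2) // /m expnS leq_pmulr // expn_gt0 p_gt0. Qed.
Let m_gt0 : 0 < m := ltnW (ltnW m_gt2).

Lemma two_order_odd : odd d.
Proof. by rewrite oddM h_odd oddX p_odd orbT. Qed.

Lemma two_exp_order : 2 ^ d = 1 %[mod m].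
Proof.
have [_ [+ _]] := ord2 => /eqP; rewrite eqn_mod_dvd ?expn_gt0 // => /dvdnP[u Du].
have {}Du : 2 ^ h = 1 + p * u by rewrite mulnC -Du subnKC ?expn_gt0.
have [v Dv] := expn_1D_pfactor u e.
by rewrite /d expnM Du Dv addnC mulnC modnMDl.
Qed.

(** The factors h and p^e of d are coprime. Reduction modulo p yields h; p^e comes from writing
    2^(p-1) = 1 + p u, where p does not divide u by the condition modulo p^2. *)
Lemma two_order_min j : 2 ^ j = 1 %[mod m] -> d %| j.
Proof.
move=> E; have p_dv_m : p %| m by rewrite /m expnS dvdn_mulr.
rewrite Gauss_dvd; last first.
  rewrite coprimeXr // coprime_sym prime_coprime // gtnNdvd //; first by case: (h) h_odd.
  by rewrite /h; clear -p_gt2; lia.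
apply/andP; split.
  by apply: (order_dvd ord2); rewrite -(modn_dvdm _ p_dv_m) E modn_dvdm.
case: wieferich => [->|W]; first by rewrite expn0 dvd1n.
have p2 : coprime 2 p by rewrite coprime2n.
have := Euler_exp_totient p2; rewrite totient_prime // => /eqP.
rewrite eqn_mod_dvd ?expn_gt0 // => /dvdnP[u Du].
have {}Du : 2 ^ p.-1 = 1 + p * u by rewrite mulnC -Du subnKC ?expn_gt0.
apply: (@pfactor_dvd_exponent u).
  apply/negP => /dvdnP[v Dv]; apply: W.
  by rewrite Du Dv mulnCA mulnn addnC modnMDl.
by rewrite -Du -expnM mulnC expnM -modnXm E modnXm exp1n.
Qed.

(** Counting, with [m.-1] in the role of -1: the residues 2^i and -2^i for i < d are distinct, since
    an equality between the two kinds raised to the odd power d would give -1 = 1, and their number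
    2d is the totient of m. *)
Lemma units_pm_two k : coprime k m ->
  exists i, k = 2 ^ i %[mod m] \/ k = m.-1 * 2 ^ i %[mod m].
Proof.
have co2 i : coprime (2 ^ i) m by rewrite coprimeXl // coprime2n /m oddX p_odd orbT.
have com : coprime m.-1 m by rewrite coprimePn.
have inj2 i j : 2 ^ i = 2 ^ j %[mod m] -> i < d -> j < d -> i = j.
  wlog le_ij : i j / i <= j => [IH E|].
    by have [/IH|/ltnW/IH] := leqP i j => IH' *; [apply: IH' | apply/esym/IH'].
  move=> /esym/eqP; rewrite eqn_mod_dvd ?leq_exp2l // => + _ lt_j.
  rewrite -(subnKC le_ij) expnD -[X in _ - X]muln1 -mulnBr Gauss_dvdr 1?coprime_sym //.
  rewrite -eqn_mod_dvd ?expn_gt0 // => /eqP/two_order_min dv.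
  have: j - i = 0; last by clear -le_ij; lia.
  apply/eqP; apply: contraTT dv; rewrite -lt0n => lt0; rewrite gtnNdvd //.
  by rewrite (leq_ltn_trans (leq_subr _ _)).
have m1sq : m.-1 * m.-1 = 1 %[mod m].
  have -> : m.-1 * m.-1 = m.-2 * m + 1 by clear -m_gt2; nia.
  by rewrite modnMDl.
have mul_m1 x y : m.-1 * x = m.-1 * y %[mod m] -> x = y %[mod m].
  move=> E; rewrite -[x]mul1n -[y]mul1n -modnMml -m1sq modnMml -mulnA -modnMmr E.
  by rewrite modnMmr mulnA -modnMml m1sq modnMml.
have disj i j : m.-1 * 2 ^ i <> 2 ^ j %[mod m].
  move=> E; have : (m.-1 * 2 ^ i) ^ d = (2 ^ j) ^ d %[mod m] by rewrite -modnXm E modnXm.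
  have pow1 l : (2 ^ l) ^ d = 1 %[mod m].
    by rewrite -expnM mulnC expnM -modnXm two_exp_order modnXm exp1n.
  rewrite pow1 expnMn -modnMmr pow1 modnMmr muln1.
  rewrite -(odd_double_half d) two_order_odd expnD expn1 -mul2n expnM -mulnn.
  rewrite -modnMmr -modnXm m1sq modnXm exp1n modnMmr muln1 !modn_small //.
  - by clear -m_gt2; lia.
  - by clear -m_gt2; lia.
  by clear -m_gt2; lia.
pose S := [seq 2 ^ i %% m | i <- iota 0 d] ++ [seq (m.-1 * 2 ^ i) %% m | i <- iota 0 d].
pose T := [seq k <- iota 0 m | coprime k m].
have uniqS : uniq S.
  rewrite cat_uniq !map_inj_in_uniq ?iota_uniq ?andbT /=.
  - apply/hasPn => _ /mapP[i _ ->]; apply/negP => /mapP[j _ E]; exact: (@disj i j).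
  - by move=> i j; rewrite !mem_iota /= => lt_i lt_j /mul_m1/inj2; apply.
  by move=> i j; rewrite !mem_iota /= => lt_i lt_j /inj2; apply.
have subST : {subset S <= T}.
  move=> x; rewrite mem_cat => /orP[] /mapP[i _ ->];
    by rewrite mem_filter mem_iota /= ltn_pmod // coprime_modl ?coprimeMl ?com co2.
have szST : size T <= size S.
  rewrite size_cat !size_map !size_iota size_filter.
  rewrite count_coprime.
  have h2 : h + h = p.-1 by rewrite /h; clear -p_odd; lia.
  by rewrite /m totient_pfactor // /d -mulnDl h2.
have [_ memST] := uniq_min_size uniqS subST szST.
move=> co; have : k %% m \in S.
  by rewrite memST mem_filter mem_iota /= ltn_pmod // coprime_modl co.
by rewrite mem_cat => /orP[] /mapP[i _ E]; exists i; [left | right].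
Qed.

End UnitsModPrimePower.

Local Open Scope ring_scope.

(** * Galois conjugates in cyclotomic rings *)

Definition zeval (R : comNzRingType) (x : R) : {poly int} -> R :=
  horner_eval x \o map_poly intr.

HB.instance Definition _ (R : comNzRingType) (x : R) :=
  GRing.RMorphism.copy (zeval x) (horner_eval x \o map_poly intr).

Section Zeval.
Variable R : comNzRingType.
Implicit Types (x : R) (P Q : {poly int}).

Lemma zevalXn x n : zeval x 'X^n = x ^+ n.
Proof. by rewrite /zeval /= map_polyXn /horner_eval hornerXn. Qed.

Lemma zevalC x c : zeval x c%:P = c%:~R.
Proof. by rewrite /zeval /= map_polyC /horner_eval hornerC. Qed.

Lemma zeval_comp x P Q : zeval x (P \Po Q) = zeval (zeval x Q) P.
Proof. by rewrite /zeval /= map_comp_poly /horner_eval horner_comp. Qed.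

Lemma zeval_compXn x P n : zeval x (P \Po 'X^n) = zeval (x ^+ n) P.
Proof. by rewrite zeval_comp zevalXn. Qed.

Lemma zeval_sum x P n : (size P <= n)%N ->
  zeval x P = \sum_(i < n) (P`_i)%:~R * x ^+ i.
Proof.
move=> le_n; rewrite /zeval /= /horner_eval (@horner_coef_wide _ n).
  by apply: eq_bigr => i _; rewrite coef_map.
by apply: leq_trans le_n; exact: size_poly.
Qed.

End Zeval.

Section Galois.
Variables (F : numFieldType) (m : nat) (z : F).
Hypothesis prim_z : m.-primitive_root z.
Let m_gt0 : (0 < m)%N := prim_order_gt0 prim_z.

Lemma zeval_Cyclotomic (y : F) : m.-primitive_root y -> zeval y 'Phi_m = 0.
Proof.
move=> prim_y.
have : zeval y (\prod_(d <- divisors m) 'Phi_d) = 0.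
  by rewrite prod_Cyclotomic // rmorphB rmorph1 /= zevalXn prim_expr_order ?subrr.
rewrite rmorph_prod /= => /eqP; rewrite prodf_seq_eq0 => /hasP[d].
rewrite -dvdn_divisors // => d_dv_m /= /eqP Phi0.
have d_gt0 := dvdn_gt0 m_gt0 d_dv_m.
have yd : y ^+ d = 1.
  apply/eqP; rewrite -subr_eq0 -zevalXn -[1](rmorph1 (zeval y)) -rmorphB /=.
  rewrite -prod_Cyclotomic // (big_rem d) -?dvdn_divisors //=.
  by rewrite rmorphM /= Phi0 mul0r.
suff -> : m = d by [].
by apply/eqP; rewrite eqn_dvd d_dv_m (prim_order_dvd prim_y) yd eqxx.
Qed.

(** Irreducibility is available in [algC], not in [F], so the argument passes through Q[X]: the
    common root z makes the gcd with Phi_m nontrivial, the gcd has a root in [algC], and Phi_m is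
    the minimal polynomial of that root. As Phi_m is monic, the quotient is integral. *)
Lemma Cyclotomic_dvd_of_root (Q : {poly int}) : zeval z Q = 0 ->
  exists T, Q = T * 'Phi_m.
Proof.
move=> Qz0; pose toQ : {poly int} -> {poly rat} := map_poly intr.
have toF P : map_poly ratr (toQ P) = map_poly intr P :> {poly F}.
  by rewrite -map_poly_comp; apply: eq_map_poly => c /=; rewrite rmorph_int.
have toC P : map_poly ratr (toQ P) = map_poly intr P :> {poly algC}.
  by rewrite -map_poly_comp; apply: eq_map_poly => c /=; rewrite rmorph_int.
have dvd_rat : toQ 'Phi_m %| toQ Q.
  have ncop : ~~ coprimep (toQ 'Phi_m) (toQ Q).
    apply/negP => cop.
    have cop' : coprimep (map_poly ratr (toQ 'Phi_m) : {poly F})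
                         (map_poly ratr (toQ Q)) by rewrite coprimep_map.
    have := coprimep_root cop' (x := z).
    rewrite !toF /root => /(_ _)/negP; apply; last by apply/eqP; exact: Qz0.
    by apply/eqP; exact: zeval_Cyclotomic.
  have g_dv : gcdp (toQ 'Phi_m) (toQ Q) %| toQ 'Phi_m by exact: dvdp_gcdl.
  have [y gy0] : exists y : algC, root (map_poly ratr (gcdp (toQ 'Phi_m) (toQ Q))) y.
    have [[|y r] Dg] := closed_field_poly_normal
      (map_poly ratr (gcdp (toQ 'Phi_m) (toQ Q)) : {poly algC}).
      case/negP: ncop; rewrite /coprimep -(size_map_poly (ratr : rat -> algC)).
      rewrite Dg big_nil size_scale ?size_poly1 //.
      rewrite lead_coef_eq0 map_poly_eq0 gcdp_eq0 negb_and.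
      rewrite -size_poly_eq0 size_map_inj_poly //; last exact: intr_inj.
      by rewrite size_Cyclotomic.
    by exists y; rewrite Dg rootZ ?root_prod_XsubC ?mem_head // lead_coef_eq0
        map_poly_eq0 gcdp_eq0 negb_and -size_poly_eq0 size_map_inj_poly //;
       [rewrite size_Cyclotomic | exact: intr_inj].
  have rootC P : gcdp (toQ 'Phi_m) (toQ Q) %| toQ P -> root (map_poly ratr (toQ P)) y.
    by case/dvdpP=> h ->; rewrite rmorphM rootM gy0 orbT.
  have [w prim_w] := C_prim_root_exists m_gt0.
  have prim_y : m.-primitive_root y.
    by have := rootC _ g_dv; rewrite toC (Cintr_Cyclotomic prim_w) root_cyclotomic.
  have [f [Df mon_f] dv_f] := minCpolyP y.
  have <- : f = toQ 'Phi_m.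
    apply: (map_inj_poly (fmorph_inj (ratr : rat -> algC))); first exact: rmorph0.
    by rewrite toC -Df (minCpoly_cyclotomic prim_y) (Cintr_Cyclotomic prim_y).
  by rewrite -dv_f rootC // dvdp_gcdr.
have mon := Cyclotomic_monic m.
exists (Pdiv.Ring.rdivp Q 'Phi_m); rewrite {1}(Pdiv.RingMonic.rdivp_eq mon Q).
suff -> : Pdiv.Ring.rmodp Q 'Phi_m = 0 by rewrite addr0.
apply: (map_inj_poly (intr_inj : injective (intr : int -> rat))) => //.
rewrite -[map_poly _ _]/(toQ _) rmorph0; apply/eqP; apply: contraTT dvd_rat.
move=> nz; rewrite {1}(Pdiv.RingMonic.rdivp_eq mon Q) /toQ rmorphD rmorphM /=.
rewrite dvdp_addr ?dvdp_mull //; apply/negP => /(dvdp_leq nz).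
rewrite !size_map_inj_poly //; try exact: intr_inj.
by rewrite leqNgt Pdiv.CommonRing.ltn_rmodp monic_neq0.
Qed.

Lemma zeval_galois (Q : {poly int}) k : coprime k m ->
  zeval z Q = 0 -> zeval (z ^+ k) Q = 0.
Proof.
move=> co /Cyclotomic_dvd_of_root[T ->]; rewrite rmorphM /=.
by rewrite zeval_Cyclotomic ?mulr0 // prim_root_exp_coprime.
Qed.

Lemma zeval_galois_eq (P Q : {poly int}) k : coprime k m ->
  zeval z P = zeval z Q -> zeval (z ^+ k) P = zeval (z ^+ k) Q.
Proof.
move=> co /eqP; rewrite -subr_eq0 -rmorphB => /eqP/(zeval_galois co)/eqP.
by rewrite rmorphB subr_eq0 => /eqP.
Qed.

(** One remainder serves all conjugates at once, because Phi_m vanishes at each of them. *)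
Lemma zeval_reduce (Q : {poly int}) : exists2 R : {poly int},
  (size R <= totient m)%N &
  forall k, coprime k m -> zeval (z ^+ k) R = zeval (z ^+ k) Q.
Proof.
have mon := Cyclotomic_monic m.
exists (Pdiv.Ring.rmodp Q 'Phi_m) => [|k co].
  by rewrite -ltnS -size_Cyclotomic Pdiv.CommonRing.ltn_rmodp monic_neq0.
rewrite {2}(Pdiv.RingMonic.rdivp_eq mon Q) rmorphD rmorphM /=.
by rewrite zeval_Cyclotomic ?mulr0 ?add0r // prim_root_exp_coprime.
Qed.

(* A remainder modulo Phi_m of degree < phi(m) taking the same value at all
   phi(m) primitive roots is constant. *)
Lemma zeval_fixed_int (Q : {poly int}) (v : F) :
  (forall k, coprime k m -> zeval (z ^+ k) Q = v) -> exists a : int, v = a%:~R.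
Proof.
move=> fixQ; have [R szR eqR] := zeval_reduce Q.
pose S : {poly F} := map_poly intr R - v%:P.
have S0 : S = 0.
  pose ks := [seq k <- iota 0 m | coprime k m].
  apply: (@roots_geq_poly_eq0 _ _ [seq z ^+ k | k <- ks]).
  - apply/allP => _ /mapP[k + ->]; rewrite mem_filter => /andP[co _].
    by rewrite /root hornerD hornerN hornerC -[_.[_]]/(zeval _ R) eqR // fixQ // subrr.
  - rewrite map_inj_in_uniq ?filter_uniq ?iota_uniq // => i j.
    rewrite !mem_filter !mem_iota /= => /andP[_ lt_i] /andP[_ lt_j] /eqP.
    by rewrite (eq_prim_root_expr prim_z) !modn_small // => /eqP.
  rewrite size_map size_filter.
  rewrite count_coprime.
  rewrite (leq_trans (size_polyD _ _)) // geq_max size_polyN.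
  rewrite (leq_trans (size_poly _ _) szR) (leq_trans (size_polyC_leq1 v)) //.
  by rewrite totient_gt0.
exists R`_0; apply/eqP; rewrite eq_sym -subr_eq0.
by have := congr1 (fun s : {poly F} => s`_0) S0; rewrite coefB coefC coef_map coef0 => ->.
Qed.

End Galois.

(** * Frobenius stability of ideals above 2 *)

(** Each squaring raises the 2-adic precision of a congruence by one. *)
Lemma exprn2_congr (R : comNzRingType) (b c : R) N :
  exists c', (b + 2 * c) ^+ (2 ^ N) = b ^+ (2 ^ N) + 2 ^+ N.+1 * c'.
Proof.
elim: N => [|N [c' IH]]; first by exists c; rewrite !expr1.
exists (b ^+ (2 ^ N) * c' + 2 ^+ N * c' ^+ 2).
by rewrite expnS mulnC !exprM IH !exprS; ring.
Qed.

Lemma exprD_congr (R : comNzRingType) (a b c : R) n :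
  exists c', (b + a * c) ^+ n = b ^+ n + a * c'.
Proof.
elim: n => [|n [c' IH]]; first by exists 0; rewrite !expr0; ring.
by exists (c * b ^+ n + (b + a * c) * c'); rewrite !exprS IH; ring.
Qed.

(** Squaring is additive modulo 2 and fixes integer coefficients modulo 2. *)
Lemma comp_X2_congr (P : {poly int}) :
  exists U, P \Po 'X^2 = P ^+ 2 + 2 * U.
Proof.
elim/poly_ind: P => [|P c [U IH]]; first by exists 0; rewrite comp_poly0; ring.
have [d Dc] : exists d : int, c = c ^+ 2 + 2 * d.
  pose k := (c %/ 2)%Z; pose r := (c %% 2)%Z.
  have Dc : c = k * 2 + r by exact: divz_eq.
  have Dr : r ^+ 2 = r by have [->|->] : r = 0 \/ r = 1 by lia.
  exists (k - 2 * k ^+ 2 - 2 * k * r).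
  by clearbody k r; rewrite Dc -[in LHS]Dr; ring.
exists ('X ^+ 2 * U - P * 'X * c%:P + d%:P).
rewrite comp_polyD comp_polyM comp_polyX comp_polyC IH.
by rewrite {1}Dc polyCD !polyCM; ring.
Qed.

Lemma comp_X2n_congr (P : {poly int}) d :
  exists U, P ^+ (2 ^ d) = P \Po 'X^(2 ^ d) + 2 * U.
Proof.
elim: d => [|d [U IH]]; first by exists 0; rewrite expn0 !expr1 comp_polyXr; ring.
have [V DV] := comp_X2_congr (P \Po 'X^(2 ^ d)).
exists (2 * (U * (P \Po 'X^(2 ^ d))) + 2 * U ^+ 2 - V).
rewrite expnS mulnC exprM IH.
have -> : P \Po 'X^(2 ^ d * 2) = (P \Po 'X^(2 ^ d)) \Po 'X^2.
  by rewrite -comp_polyA comp_Xn_poly -exprM mulnC.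
by rewrite DV; ring.
Qed.

Section Frobenius.
Variables (F : numFieldType) (m d : nat) (z : F).
Hypotheses (prim_z : m.-primitive_root z) (m_odd : odd m).
Hypotheses (d_gt0 : (0 < d)%N) (ord2 : z ^+ (2 ^ d) = z).

(* The idempotent [E] of Z[z]/2^(t+1) attached to [y] is fixed by the Frobenius
   and lies in (y), while [y] - [y E] is divisible by 2: this reduces the
   exponent by one. *)
Lemma frobenius_stable t (y : {poly int}) : exists a b : {poly int},
  zeval (z ^+ 2) y = zeval z a * zeval z y + 2 ^+ t * zeval z b.
Proof.
elim: t y => [|t IH] y.
  by exists 0, (y \Po 'X^2); rewrite zeval_compXn rmorph0; ring.
pose q := (2 ^ d)%N; have q_ge2 : (1 < q)%N by rewrite -(expn0 2) ltn_exp2l.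
have q_gt0 := ltnW q_ge2.
have [U DU] := comp_X2n_congr y d; rewrite -/q in DU.
have Yq : zeval z y ^+ q = zeval z y + 2 * zeval z U.
  by rewrite -rmorphXn DU rmorphD rmorphM /= zeval_compXn ord2 rmorph_nat.
(* Modulo 2 one has y^q = y, so y^(q-1) is idempotent there; its 2^t-th power is idempotent modulo
   2^(t+1). *)
pose eps := y ^+ (q.-1 * 2 ^ t); pose Y := zeval z y; pose E := zeval z eps.
have [y' Dy'] : exists y', zeval z (y - y * eps) = 2 * zeval z y'.
  rewrite /eps exprM; move: (2 ^ t)%N => n.
  have [c Dc] : exists c, zeval z (y * (y ^+ q.-1) ^+ n) = zeval z (y + 2 * c).
    elim: n => [|n [c IHn]]; first by exists 0; rewrite expr0; congr zeval; ring.
    exists (U + c * y ^+ q.-1).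
    rewrite exprSr mulrA rmorphM /= IHn -rmorphM mulrDl.
    have -> : y * y ^+ q.-1 = y ^+ q by rewrite -exprS prednK.
    by rewrite !rmorphD !rmorphM /= rmorphXn /= Yq !rmorph_nat; ring.
  by exists (- c); rewrite rmorphB /= Dc rmorphD !rmorphM rmorphN /= rmorph_nat; ring.
have [V1 DV1] : exists V, zeval (z ^+ 2) eps = E ^+ 2 + 2 ^+ t.+1 * zeval z V.
  have [W DW] := comp_X2_congr y.
  have [c Dc] := exprn2_congr (y ^+ 2) W t.
  have [c' Dc'] := exprD_congr (2 ^+ t.+1) ((y ^+ 2) ^+ (2 ^ t)) c q.-1.
  exists c'; rewrite -zeval_compXn.
  have -> : eps \Po 'X^2 = ((y \Po 'X^2) ^+ (2 ^ t)) ^+ q.-1.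
    by rewrite /eps mulnC exprM !rmorphXn.
  rewrite DW Dc Dc' rmorphD rmorphM /= [zeval z (2 ^+ _)]rmorphXn /= rmorph_nat.
  by congr (_ + _); rewrite /E -rmorphXn /eps -!exprM; congr (zeval z (_ ^+ _)); lia.
have [V2 DV2] : exists V, E ^+ 2 = E + 2 ^+ t.+1 * zeval z V.
  have [c Dc] := exprn2_congr y U t.
  (* Splits q - 1 = 1 + (q - 2) and 2 (q - 1) = q + (q - 2), so that E and its square differ only by
     y against y^q. *)
  pose r := zeval z y ^+ (q.-2 * 2 ^ t).
  have DE : E = Y ^+ (2 ^ t) * r.
    by rewrite /E /eps rmorphXn /r /= -exprD; congr (_ ^+ _); nia.
  have DE2 : E ^+ 2 = (Y ^+ q) ^+ (2 ^ t) * r.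
    by rewrite /E /eps rmorphXn /r /= -!exprM -exprD; congr (_ ^+ _); nia.
  exists (c * y ^+ (q.-2 * 2 ^ t)); rewrite DE2 Yq DE.
  have := congr1 (zeval z) Dc; rewrite rmorphXn !rmorphD !rmorphM !rmorphXn /= rmorph_nat.
  by move=> ->; rewrite -/r; ring.
have Es : zeval (z ^+ 2) (y - y * eps) = zeval (z ^+ 2) (2 * y').
  apply: (zeval_galois_eq prim_z); first by rewrite coprime2n.
  by rewrite Dy' rmorphM rmorph_nat.
have [a [b Dab]] := IH y'.
have [E1 DE1] : exists E1, eps = y * E1.
  exists (y ^+ (q.-1 * 2 ^ t).-1); rewrite -exprS prednK //.
  by rewrite muln_gt0 expn_gt0 andbT; lia.
(* Here sigma(y) = sigma(y) sigma(E) + 2 sigma(y'). Modulo 2^(t+1) the first term is sigma(y) E =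
   sigma(y) E1 y, and by induction the second is a (y - y E). *)
exists (a - a * eps + (y \Po 'X^2) * E1).
exists (b + (y \Po 'X^2) * (V1 + V2)).
have DE : zeval z eps = zeval z y * zeval z E1 by rewrite DE1 rmorphM.
have D2 : 2 * zeval z y' = zeval z y - zeval z y * zeval z eps.
  by rewrite -Dy' rmorphB rmorphM.
have Ey : zeval (z ^+ 2) y = zeval (z ^+ 2) y * zeval (z ^+ 2) eps
     + 2 * zeval (z ^+ 2) y'.
  move: Es; rewrite rmorphB !rmorphM /= rmorph_nat => <-; ring.
rewrite rmorphD rmorphB !rmorphM rmorphD rmorphM /= rmorphD /= !zeval_compXn.
rewrite {1}Ey Dab mulrDr mulrCA D2 DV1 DV2 /E DE [2 ^+ t.+1]exprS.
by ring.
Qed.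

End Frobenius.

(** * Cyclotomic integers all of whose conjugates have modulus one *)

Lemma sum_unity_root (F : fieldType) n (y : F) : y ^+ n = 1 -> y != 1 ->
  \sum_(k < n) y ^+ k = 0.
Proof.
move=> yn y1; apply: (mulfI (x := y - 1)); first by rewrite subr_eq0.
by rewrite -subrX1 yn subrr mulr0.
Qed.

Lemma big_ord_mul (R : nmodType) p n (f : nat -> R) :
  \sum_(i < p * n) f i = \sum_(r < n) \sum_(j < p) f (r + n * j)%N.
Proof.
rewrite exchange_big /=; elim: p => [|p IH]; first by rewrite mul0n !big_ord0.
rewrite big_ord_recr /= -IH mulSn addnC big_split_ord /=; congr (_ + _).
by apply: eq_bigr => i _; rewrite addnC mulnC.
Qed.

Section Parseval.
Variable C : numClosedFieldType.

Lemma conj_unity_root n (x : C) : (0 < n)%N -> x ^+ n = 1 -> x^* = x^-1.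
Proof.
move=> n_gt0 xn; have nx1 : `|x| = 1.
  by apply/eqP; rewrite -(pexpr_eq1 n_gt0) // -normrX xn normr1.
by rewrite invC_norm nx1 expr1n invr1 mul1r.
Qed.

Lemma parseval n (w : C) (a : 'I_n -> C) : n.-primitive_root w ->
  \sum_(k < n) `|\sum_i a i * (w ^+ k) ^+ i| ^+ 2 = n%:R * \sum_i `|a i| ^+ 2.
Proof.
move=> prim_w; have n_gt0 := prim_order_gt0 prim_w.
have wn := prim_expr_order prim_w.
have w0 : w != 0 by apply: contra_eq_neq wn => ->; rewrite expr0n eqn0Ngt n_gt0 eq_sym oner_eq0.
have E k : `|\sum_i a i * (w ^+ k) ^+ i| ^+ 2
    = \sum_i \sum_j (a i * (a j)^*) * (w ^+ i / w ^+ j) ^+ k.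
  rewrite normCK rmorph_sum big_distrlr /=; apply: eq_bigr => i _.
  apply: eq_bigr => j _; rewrite rmorphM !rmorphXn /= (conj_unity_root n_gt0 wn).
  by rewrite mulrACA exprMn !exprVn -!exprM ![(k * _)%N]mulnC.
rewrite (eq_bigr _ (fun (k : 'I_n) _ => E k)) exchange_big mulr_sumr /=.
apply: eq_bigr => i _; rewrite exchange_big (bigD1 i) //= [X in _ + X]big1.
  rewrite divff ?expf_neq0 // addr0 -mulr_sumr.
  rewrite (eq_bigr (fun=> 1)); last by move=> ? _; rewrite expr1n.
  by rewrite sumr_const card_ord -normCK mulrC.
move=> j neq; rewrite -mulr_sumr sum_unity_root ?mulr0 //.
  by rewrite exprMn exprVn -!exprM ![(_ * n)%N]mulnC !exprM wn !expr1n invr1 mulr1.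
apply: contra neq => /eqP E1.
have : w ^+ i == w ^+ j by rewrite -[w ^+ j]mul1r -E1 divfK // expf_neq0.
by rewrite (eq_prim_root_expr prim_w) !modn_small // eq_sym.
Qed.

End Parseval.

Section Dispersion.
Variables (p : nat) (a : 'I_p -> int).
Hypothesis p_gt2 : (2 < p)%N.

(** By Parseval, the first term is the sum over all c of |sum_j a_j w^(cj)|^2 for a primitive p-th
    root w; the subtracted square is the share of c = 0. The result is p^2 times the variance of the
    a_i. *)
Definition dispersion := p%:Z * (\sum_i a i ^+ 2) - (\sum_i a i) ^+ 2.

Lemma double_dispersion : 2 * dispersion = \sum_i \sum_j (a i - a j) ^+ 2.
Proof.
have E i : \sum_j (a i - a j) ^+ 2
    = p%:Z * a i ^+ 2 + \sum_j a j ^+ 2 - 2 * a i * \sum_j a j.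
  rewrite (eq_bigr (fun j => a i ^+ 2 + a j ^+ 2 - 2 * a i * a j)).
    by rewrite sumrB big_split /= sumr_const card_ord -mulr_sumr -[_ *+ p]mulr_natl natz.
  by move=> j _; ring.
rewrite (eq_bigr _ (fun i _ => E i)) sumrB big_split /= sumr_const card_ord.
rewrite -mulr_sumr -mulr_suml -mulr_sumr /dispersion -[_ *+ p]mulr_natl natz; ring.
Qed.

Lemma dispersion_ge0 : 0 <= dispersion.
Proof.
rewrite -(pmulr_rge0 _ (ltr0n _ 2)) double_dispersion.
by apply: sumr_ge0 => i _; apply: sumr_ge0 => j _; exact: sqr_ge0.
Qed.

(** If a_i and a_j differ, each of the p - 2 other entries differs from one of them, so the
    unordered pairs contribute at least 1 + (p - 2). Equality makes the other entries all equal, and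
    equal to one of a_i, a_j, while the remaining one is off by 1. *)
Lemma dispersion_min : dispersion <= p.-1%:Z ->
  (dispersion = 0 /\ exists c, forall i, a i = c) \/
  (dispersion = p.-1%:Z /\ exists i0 (s : bool) c,
    forall i, a i = c + (-1) ^+ s * (i == i0)%:Z).
Proof.
have [/forallP cst|] := boolP [forall i, a i == a (Ordinal (ltnW (ltnW p_gt2)))].
  move=> _; left; split; last by eexists => i; exact/eqP/cst.
  apply: (mulfI (x := 2)) => //; rewrite double_dispersion mulr0 big1 // => i _.
  by rewrite big1 // => j _; rewrite (eqP (cst i)) (eqP (cst j)) subrr expr0n.
case/forallPn=> i; move: (Ordinal _) => j ne_ij le_D; right.
have ij : i != j by apply: contra ne_ij => /eqP ->.
pose d k l := (a k - a l) ^+ 2.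
have dC k l : d k l = d l k by rewrite /d -sqrrN opprB.
have dkk k : d k k = 0 by rewrite /d subrr expr0n.
have d_ge0 k l : 0 <= d k l by exact: sqr_ge0.
have d_gt0 k l : a k != a l -> 1 <= d k l.
  move=> ne; rewrite -gtz0_ge1 lt_neqAle eq_sym d_ge0 andbT sqrf_eq0 subr_eq0 //.
pose S := \sum_(k | (k != i) && (k != j)) (d i k + d j k - 1).
pose T := \sum_(k | (k != i) && (k != j)) \sum_(l | (l != i) && (l != j)) d k l.
have split2 (f : 'I_p -> int) :
    \sum_k f k = f i + (f j + \sum_(k | (k != i) && (k != j)) f k).
  by rewrite (bigD1 i) //= (bigD1 j) //= eq_sym.
have card_rest : \sum_(k | (k != i) && (k != j)) (1 : int) = p%:Z - 2.
  have := split2 (fun=> 1); rewrite sumr_const card_ord natz => ->; ring.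
have DD : 2 * dispersion = 2 * (d i j - 1) + 2 * S + T + 2 * (p%:Z - 1).
  have row k : \sum_l d k l = d k i + (d k j + \sum_(l | (l != i) && (l != j)) d k l).
    exact: split2.
  have -> : 2 * dispersion = \sum_k \sum_l d k l by exact: double_dispersion.
  rewrite split2 !row (eq_bigr _ (fun k _ => row k)) !big_split /= -/T.
  rewrite [X in _ + (_ + (X + _))](eq_bigr (d i)); last by move=> k _; exact: dC.
  rewrite [X in _ + (_ + (_ + (X + _)))](eq_bigr (d j)); last by move=> k _; exact: dC.
  by rewrite /S sumrB big_split /= card_rest !dkk (dC j i); ring.
have dij := d_gt0 _ _ ne_ij.
have ui k : 0 <= d i k + d j k - 1.
  have [aik|aik] := eqVneq (a i) (a k).
    have := d_gt0 j k; rewrite -aik eq_sym => /(_ ne_ij).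
    by have := d_ge0 i k; lia.
  by have := d_gt0 i k aik; have := d_ge0 j k; lia.
have S_ge0 : 0 <= S by apply: sumr_ge0.
have T_ge0 : 0 <= T by apply: sumr_ge0 => k _; apply: sumr_ge0.
have [dij1 S0 T0 Dp] : [/\ d i j = 1, S = 0, T = 0 & dispersion = p.-1%:Z].
  by split; lia.
split=> //.
have rest k : (k != i) && (k != j) -> d i k + d j k = 1.
  move=> kij; have : d i k + d j k - 1 = 0.
    by apply: (psumr_eq0P _ S0) => // *; exact: ui.
  lia.
have [k0 k0ij] : exists k0, (k0 != i) && (k0 != j).
  apply/existsP; rewrite -[X in is_true X]negbK; apply/negP => /existsPn none.
  by move: card_rest; rewrite big_pred0 => [|k]; [lia | exact: negbTE].
have restc k : (k != i) && (k != j) -> a k = a k0.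
  move=> kij; apply/eqP; rewrite -subr_eq0 -sqrf_eq0 -/(d k k0); apply/eqP.
  have Tk : \sum_(l | (l != i) && (l != j)) d k l = 0.
    apply: (psumr_eq0P _ T0) => // *; exact: sumr_ge0.
  by apply: (psumr_eq0P _ Tk).
have sq1 (x : int) : x ^+ 2 = 1 -> exists s : bool, x = (-1) ^+ s.
  move/eqP; rewrite sqrf_eq1 => /orP[]/eqP->; first by exists false.
  by exists true.
have := rest _ k0ij; have [aik|aik] := eqVneq (a i) (a k0).
  rewrite {1}/d aik subrr expr0n add0r => /sq1[s Ds].
  exists j, s, (a k0) => k; have [->|kj] := eqVneq k j; first by rewrite mulr1 -Ds; lia.
  by rewrite mulr0 addr0; have [->|ki] := eqVneq k i => //; apply: restc; rewrite ki.
have [ajk|ajk] := eqVneq (a j) (a k0); last first.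
  by have := d_gt0 _ _ aik; have := d_gt0 _ _ ajk; lia.
rewrite {2}/d ajk subrr expr0n addr0 => /sq1[s Ds].
exists i, s, (a k0) => k; have [->|ki] := eqVneq k i; first by rewrite mulr1 -Ds; lia.
by rewrite mulr0 addr0; have [->|kj] := eqVneq k j => //; apply: restc; rewrite kj ki.
Qed.

End Dispersion.

Section UnitModulus.
Variables (C : numClosedFieldType) (p e : nat) (z : C).
Hypotheses (p_pr : prime p) (p_gt2 : (2 < p)%N).
Hypothesis prim_z : (p ^ e.+1).-primitive_root z.
Let n := (p ^ e)%N.
Let w := z ^+ n.

Let p_gt0 : (0 < p)%N := prime_gt0 p_pr.
Let n_gt0 : (0 < n)%N. Proof. by rewrite expn_gt0 p_gt0. Qed.
Let mE : (p ^ e.+1 = p * n)%N. Proof. exact: expnS. Qed.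

Let prim_z' : (p * n).-primitive_root z. Proof. by rewrite -mE. Qed.

Let prim_w : p.-primitive_root w.
Proof.
by have := dvdn_prim_root prim_z' (dvdn_mulr n (dvdnn p)); rewrite mulKn.
Qed.

Let prim_zp : n.-primitive_root (z ^+ p).
Proof.
by have := dvdn_prim_root prim_z' (dvdn_mull p (dvdnn n)); rewrite mulnK.
Qed.

Let norm_z k : `|z ^+ k| = 1.
Proof.
apply/eqP; rewrite -(@pexpr_eq1 _ _ (p ^ e.+1)) ?normr_ge0 ?expn_gt0 ?p_gt0 //.
by rewrite -normrX exprAC (prim_expr_order prim_z) expr1n normr1.
Qed.

(* Grouping the exponents modulo n = p^e and applying Parseval twice shows that
   the dispersions of the n blocks of coefficients add up to p - 1. *)
Lemma unit_modulus_root_of_unity (X : {poly int}) :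
  (forall k, coprime k (p ^ e.+1) -> `|zeval (z ^+ k) X| = 1) ->
  exists (s : bool) j, zeval z X = (-1) ^+ s * z ^+ j.
Proof.
move=> modX; have [R szR eqR] := zeval_reduce prim_z X.
(* Block r holds the coefficients of exponent r modulo n, so R(x) is the sum over r of x^r
   B_r(x^n). *)
pose a r (j : 'I_p) := R`_(r + n * j).
pose B r x : C := \sum_j (a r j)%:~R * x ^+ j.
have evR k : zeval (z ^+ k) R = \sum_(r < n) (z ^+ k) ^+ r * B r (w ^+ k).
  rewrite (@zeval_sum _ _ _ (p * n)); last first.
    apply: (leq_trans szR); rewrite -mE totient_pfactor // mulnC.
    by rewrite expnSr leq_mul // leq_pred.
  rewrite (big_ord_mul _ _ (fun i => (R`_i)%:~R * (z ^+ k) ^+ i)).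
  apply: eq_bigr => r _; rewrite mulr_sumr; apply: eq_bigr => j _.
  by rewrite exprD mulrCA [_ ^+ (n * j)]exprM [_ ^+ n]exprAC.
(* The n exponents c + p l are prime to p and share the same power of w, so the B_r do not change
   with l; Parseval for the root z^p averages the unit moduli. *)
have sumB c : coprime c p -> \sum_(r < n) `|B r (w ^+ c)| ^+ 2 = 1.
  move=> co_c; have := parseval (fun r : 'I_n => (z ^+ c) ^+ r * B r (w ^+ c)) prim_zp.
  rewrite (eq_bigr (fun=> 1)) => [|l _].
    rewrite sumr_const card_ord => En.
    have {En} : n%:R * 1 = n%:R * \sum_(r < n) `|B r (w ^+ c)| ^+ 2 :> C.
      rewrite mulr1 {1}En; congr (_ * _); apply: eq_bigr => r _.
      by rewrite normrM -exprM norm_z mul1r.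
    by move/(mulfI _) => <- //; rewrite pnatr_eq0 -lt0n.
  have co : coprime (c + p * l) (p ^ e.+1).
    by rewrite coprimeXr // coprime_sym prime_coprime // dvdn_addl ?dvdn_mulr //
      -prime_coprime // coprime_sym.
  rewrite -[RHS](expr1n _ 2) -(modX _ co) -eqR // evR; congr (`| _ | ^+ 2).
  apply: eq_bigr => r _.
  have -> : w ^+ (c + p * l) = w ^+ c.
    by rewrite exprD exprM (prim_expr_order prim_w) expr1n mulr1.
  by rewrite exprD exprMn [z ^+ (p * l)]exprM mulrAC.
(* Parseval for w turns each dispersion into the sum over c other than 0 of |B_r(w^c)|^2; summing
   over r gives 1 for each of the p - 1 values of c. *)
have sumD : \sum_(r < n) dispersion (a r) = p.-1%:Z.
  apply: (@intr_inj C); rewrite rmorph_sum /=.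
  pose c0 := Ordinal p_gt0.
  have E (r : 'I_n) : (dispersion (a r))%:~R
      = \sum_(c < p | c != c0) `|B r (w ^+ c)| ^+ 2 :> C.
    have := parseval (fun j => (a r j)%:~R : C) prim_w.
    rewrite (bigD1 c0) //= => Ep; apply: (addrI (`|B r (w ^+ c0)| ^+ 2)).
    have Bw0 : B r (w ^+ c0) = (\sum_i a r i)%:~R.
      rewrite rmorph_sum; apply: eq_bigr => i _.
      by rewrite -exprM mul0n expr0 mulr1.
    rewrite [X in _ = X]Ep Bw0 -intr_norm -rmorphXn /= real_normK ?num_real //.
    rewrite -rmorphD /= /dispersion addrC subrK rmorphM rmorph_sum /=.
    congr (_ * _); apply: eq_bigr => i _.
    by rewrite -intr_norm -rmorphXn /= real_normK ?num_real.
  rewrite (eq_bigr _ (fun r _ => E r)) exchange_big /=.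
  rewrite (eq_bigr (fun=> 1)) => [|c nc].
    by rewrite sumr_const cardC1 card_ord.
  apply: sumB; rewrite coprime_sym prime_coprime // gtnNdvd //.
  by rewrite lt0n; apply: contra nc => /eqP E0; apply/eqP/val_inj.
have D_le (r : 'I_n) : dispersion (a r) <= p.-1%:Z.
  rewrite -sumD (bigD1 r) //= lerDl; apply: sumr_ge0 => *; exact: dispersion_ge0.
have sum_w : \sum_(j < p) w ^+ j = 0.
  apply: sum_unity_root; first exact: prim_expr_order.
  by rewrite -(prim_order_dvd prim_w 1) dvdn1; lia.
have [r0] : exists r0 : 'I_n, dispersion (a r0) != 0.
  apply/existsP; rewrite -[X in is_true X]negbK; apply/negP => /existsPn none.
  move: sumD; rewrite big1 => [|r _]; first lia.
  by apply/eqP; have := none r; rewrite negbK.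
case: (dispersion_min p_gt2 (D_le r0)) => [[-> //]|[Dr0 [i0 [s [c Da]]]] _].
(* The block r0 already uses up the whole total p - 1, so every other block is constant and is
   killed by the vanishing sum of the powers of w. *)
have B0 (r : 'I_n) : r != r0 -> B r w = 0.
  move=> ne; have Dr : dispersion (a r) = 0.
    move: sumD; rewrite (bigD1 r0) //= Dr0 -[RHS]addr0 => /addrI.
    by move/psumr_eq0P => -> // *; exact: dispersion_ge0.
  case: (dispersion_min p_gt2 (D_le r)) => [[_ [c' Da']]|[D' _]]; last by lia.
  rewrite /B (eq_bigr (fun j : 'I_p => c'%:~R * w ^+ j)) => [|j _]; last by rewrite Da'.
  by rewrite -mulr_sumr sum_w mulr0.
exists s, (r0 + n * i0)%N.
rewrite -[in LHS](expr1 z) -eqR ?coprime1n // evR !expr1.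
rewrite (bigD1 r0) //= big1 ?addr0 => [|r ne]; last by rewrite B0 ?mulr0.
rewrite /B (eq_bigr (fun j : 'I_p => c%:~R * w ^+ j + (-1) ^+ s * (j == i0)%:R * w ^+ j)).
  rewrite big_split /= -mulr_sumr sum_w mulr0 add0r (bigD1 i0) //= eqxx mulr1.
  rewrite big1 ?addr0 => [|j /negbTE->]; last by rewrite mulr0 mul0r.
  by rewrite mulrCA exprD exprM.
move=> j _; rewrite Da rmorphD rmorphM rmorphXn rmorphN rmorph1 /= mulrDl.
by case: (j == i0).
Qed.
End UnitModulus.

(** * Quadratic Gauss sums *)

Lemma sum_ord_scale (R : nmodType) p c (f : nat -> R) : (0 < p)%N -> coprime c p ->
  (forall k, f (k %% p)%N = f k) -> \sum_(k < p) f (c * k)%N = \sum_(k < p) f k.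
Proof.
move=> p_gt0 co_c per_f.
pose h (k : 'I_p) := Ordinal (ltn_pmod (c * k) p_gt0).
have inj_h : injective h.
  move=> i j; wlog le_ij : i j / (i <= j)%N => [IH E|].
    by have [/IH->|/ltnW/IH->] := leqP i j.
  move=> /(congr1 val)/= /esym/eqP; rewrite eqn_mod_dvd ?leq_mul2l ?le_ij ?orbT //.
  rewrite -mulnBr Gauss_dvdr 1?coprime_sym // => dv; apply/val_inj/eqP.
  rewrite eqn_leq le_ij -subn_eq0; apply: contraTT dv; rewrite -lt0n => lt0.
  by rewrite gtnNdvd // (leq_ltn_trans (leq_subr _ _)).
by rewrite [RHS](reindex_inj inj_h); apply: eq_bigr => k _; rewrite per_f.
Qed.

Section Legendre.
Variable p : nat.
Hypotheses (p_pr : prime p) (p_mod4 : p = 3 %[mod 4]).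
Let h := p.-1./2.

Let p_gt2 : (2 < p)%N. Proof. by move: p_mod4 (prime_gt1 p_pr); lia. Qed.
Let p_eq : p = (h + h).+1. Proof. rewrite /h; move: p_mod4; lia. Qed.
Let h_odd : odd h. Proof. move: p_eq p_mod4; lia. Qed.

(** The quadratic residue symbol, defined by Euler's criterion. Its values are at most 2 apart, less
    than p, so identities between symbols can be checked modulo p. *)
Definition legendre (k : nat) : int :=
  if (p %| k)%N then 0 else if (k ^ h == 1 %[mod p])%N then 1 else -1.

Lemma legendre_values k :
  [\/ legendre k = 0, legendre k = 1 | legendre k = -1].
Proof.
by rewrite /legendre; do 2?case: ifP => _; [constructor 1|constructor 2|constructor 3].
Qed.

Lemma legendre_congr k : (p%:Z %| legendre k - (k ^ h)%N%:Z)%Z.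
Proof.
rewrite /legendre; case: ifPn => [pk|pk].
  rewrite sub0r rpredN; apply: dvdn_exp => //; move: p_gt2 p_eq; lia.
case: ifPn => [/eqP E|ne].
  by rewrite -eqz_mod_dvd !modz_nat E.
have kh_gt0 : (0 < k ^ h)%N.
  by rewrite expn_gt0 lt0n; apply/orP; left; apply: contra pk => /eqP->.
have := @Euler_exp_totient k p; rewrite coprime_sym prime_coprime // => /(_ pk).
rewrite totient_prime // [in X in (k ^ X)%N]p_eq /= expnD => /eqP.
rewrite eqn_mod_dvd ?muln_gt0 ?kh_gt0 //.
have -> : (k ^ h * k ^ h - 1 = (k ^ h - 1) * (k ^ h + 1))%N.
  by rewrite -subn_sqr exp1n -mulnn.
rewrite Euclid_dvdM // => /orP[] dv.
  by case/negP: ne; rewrite eqn_mod_dvd.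
have -> : -1 - (k ^ h)%N%:Z = - (k ^ h + 1)%N%:Z by lia.
by rewrite rpredN.
Qed.

Lemma legendre_uniq (x y : int) : [\/ x = 0, x = 1 | x = -1] ->
  [\/ y = 0, y = 1 | y = -1] -> (p%:Z %| x - y)%Z -> x = y.
Proof.
move=> xv yv; have [//|ne] := eqVneq x y.
rewrite dvdzE absz_nat => /dvdn_leq; rewrite absz_gt0 subr_eq0 ne => /(_ isT).
by move: p_gt2 => gt2; case: xv => ->; case: yv => ->; lia.
Qed.

Lemma legendreM c k : legendre (c * k) = legendre c * legendre k.
Proof.
apply: legendre_uniq; first exact: legendre_values.
  have [->|->|->] := legendre_values c; have [->|->|->] := legendre_values k;
    by [constructor 1 | constructor 2 | constructor 3].
have -> : legendre (c * k) - legendre c * legendre k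
  = (legendre (c * k) - ((c * k) ^ h)%N%:Z)
    - legendre c * (legendre k - (k ^ h)%N%:Z)
    - (k ^ h)%N%:Z * (legendre c - (c ^ h)%N%:Z).
  by rewrite expnMn PoszM; ring.
by do 2?apply: rpredB; try apply: dvdz_mull; exact: legendre_congr.
Qed.

Lemma legendre_mod k : legendre (k %% p) = legendre k.
Proof. by rewrite /legendre /dvdn modn_mod modnXm. Qed.

Lemma legendre_opp : legendre p.-1 = -1.
Proof.
apply: legendre_uniq; [exact: legendre_values | by constructor 3|].
have := legendre_congr p.-1.
have : (p%:Z %| (p.-1 ^ h)%N%:Z + 1)%Z.
  have -> : (p.-1 ^ h)%N%:Z + 1 = p.-1%:Z ^+ h - (-1) ^+ h.
    by rewrite -signr_odd h_odd expr1 opprK -[Posz (_ ^ _)]natz natrX natz.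
  by rewrite subrXX (_ : p.-1%:Z - -1 = p%:Z) ?dvdz_mulr ?dvdzz //; move: p_gt2; lia.
by move=> d1 d2; have := rpredD d2 d1; congr dvdz; ring.
Qed.

Lemma legendre_sqr k : ~~ (p %| k)%N -> legendre k ^+ 2 = 1.
Proof. by rewrite /legendre => /negbTE->; case: ifP. Qed.

Lemma sum_legendre : \sum_(k < p) legendre k = 0.
Proof.
have := @sum_ord_scale _ p p.-1 legendre (prime_gt0 p_pr).
rewrite coprimePn ?prime_gt0 // => /(_ isT legendre_mod).
under eq_bigr do rewrite legendreM legendre_opp mulN1r.
by rewrite sumrN => /eqP; rewrite eqNr => /eqP.
Qed.

Section GaussSum.
Variables (C : numClosedFieldType) (w : C).
Hypothesis prim_w : p.-primitive_root w.

Definition gauss_sum : C := \sum_(k < p) (legendre k)%:~R * w ^+ k.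

Lemma gauss_sum_scale c : ~~ (p %| c)%N ->
  \sum_(k < p) (legendre k)%:~R * (w ^+ c) ^+ k = (legendre c)%:~R * gauss_sum.
Proof.
move=> pc; pose f k := (legendre k)%:~R * w ^+ k.
have co : coprime c p by rewrite coprime_sym prime_coprime.
have := @sum_ord_scale _ p c f (prime_gt0 p_pr) co.
rewrite -/gauss_sum => <- => [|k]; last first.
  by rewrite /f legendre_mod (prim_expr_mod prim_w).
rewrite mulr_sumr; apply: eq_bigr => k _.
rewrite /f legendreM exprM mulrA -rmorphM /= mulrA -expr2 legendre_sqr //.
by rewrite mul1r.
Qed.

Lemma gauss_sum_conj : gauss_sum^* = - gauss_sum.
Proof.
have wp := prim_expr_order prim_w; have p_gt0 := prime_gt0 p_pr.
have wV : w^* = w ^+ p.-1.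
  rewrite (conj_unity_root p_gt0 wp).
  have w0 : w != 0 by rewrite (prim_root_eq0 prim_w) -lt0n.
  by apply: (mulfI w0); rewrite -exprS prednK // wp divff.
rewrite rmorph_sum /= -mulN1r.
rewrite (_ : -1 = (legendre p.-1)%:~R); last by rewrite legendre_opp.
rewrite -gauss_sum_scale; last first.
  by rewrite gtnNdvd //; move: p_gt2; lia.
by apply: eq_bigr => k _; rewrite rmorphM rmorphXn /= rmorph_int wV.
Qed.

(** Parseval applied to the symbol gives (p - 1) |G|^2 = p (p - 1), the term at c = 0 being zero;
    the conjugate of G is -G as p is 3 modulo 4. *)
Lemma gauss_sum_sqr : gauss_sum ^+ 2 = - p%:R.
Proof.
have p_gt0 := prime_gt0 p_pr; pose c0 := Ordinal p_gt0.
have := parseval (fun k : 'I_p => (legendre k)%:~R : C) prim_w.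
rewrite (bigD1 c0) //= (eq_bigr (fun k : 'I_p => (legendre k)%:~R)) => [|i _]; last first.
  by rewrite -exprM mul0n expr0 mulr1.
rewrite -rmorph_sum sum_legendre rmorph0 normr0 expr0n add0r.
have nc (c : 'I_p) : c != c0 -> ~~ (p %| c)%N.
  move=> nc; rewrite gtnNdvd // lt0n; apply: contra nc => /eqP E0.
  exact/eqP/val_inj.
rewrite (eq_bigr (fun=> `|gauss_sum| ^+ 2)) => [|c /nc pc]; last first.
  rewrite gauss_sum_scale // normrM exprMn -intr_norm -rmorphXn /=.
  by rewrite real_normK ?num_real // legendre_sqr // mul1r.
rewrite sumr_const cardC1 card_ord [in RHS](bigD1 c0) //=.
rewrite {1}/legendre dvdn0 normr0 expr0n add0r.
rewrite (eq_bigr (fun=> 1)) => [|c /nc pc]; last first.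
  by rewrite -intr_norm -rmorphXn /= real_normK ?num_real // legendre_sqr.
rewrite sumr_const cardC1 card_ord -[_ *+ _ in LHS]mulr_natl mulrC.
move/(mulIf _) => E; have {E} : `|gauss_sum| ^+ 2 = p%:R.
  by apply: E; rewrite pnatr_eq0; move: p_gt2; lia.
by rewrite normCK gauss_sum_conj mulrN -expr2 => <-; rewrite opprK.
Qed.

End GaussSum.
End Legendre.

(** * Descent to the quadratic subfield *)

Section Descent.
Variables (C : numClosedFieldType) (p e d : nat) (z : C).
Hypotheses (p_pr : prime p) (p_mod4 : p = 3 %[mod 4]).
Let m := (p ^ e.+1)%N.
Hypothesis prim_z : m.-primitive_root z.
Hypotheses (d_odd : odd d) (ord2 : (2 ^ d = 1 %[mod m])%N).
Hypothesis gen2 : forall k, coprime k m ->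
  exists i, (k = 2 ^ i %[mod m])%N \/ (k = m.-1 * 2 ^ i %[mod m])%N.
Let w := z ^+ (p ^ e).
Let G := gauss_sum p w.

Let p_gt2 : (2 < p)%N. Proof. by move: p_mod4 (prime_gt1 p_pr); lia. Qed.
Let p_odd : odd p. Proof. by move: p_mod4; lia. Qed.
Let m_odd : odd m. Proof. by rewrite oddX p_odd orbT. Qed.
Let m_gt0 : (0 < m)%N. Proof. by rewrite expn_gt0 prime_gt0. Qed.
Let zm : z ^+ m = 1. Proof. exact: prim_expr_order. Qed.
Let z_neq0 : z != 0. Proof. by rewrite (prim_root_eq0 prim_z) -lt0n. Qed.

Let prim_w : p.-primitive_root w.
Proof.
have := @dvdn_prim_root _ _ _ prim_z p; rewrite /m expnS dvdn_mulr // => /(_ isT).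
by rewrite mulKn ?prime_gt0.
Qed.

Let expz_mod i j : (i = j %[mod m])%N -> z ^+ i = z ^+ j.
Proof. by move=> E; apply/eqP; rewrite (eq_prim_root_expr prim_z) E. Qed.

Let ord2z : z ^+ (2 ^ d) = z.
Proof. by rewrite (expz_mod ord2). Qed.

Lemma expz_pred k : (z ^+ k) ^+ m.-1 = (z ^+ k)^*.
Proof.
rewrite (@conj_unity_root _ m) //; last by rewrite exprAC zm expr1n.
apply: (mulfI (expf_neq0 k z_neq0)); rewrite divff ?expf_neq0 // -exprS prednK //.
by rewrite exprAC zm expr1n.
Qed.

Lemma zeval_conj x (P : {poly int}) : (zeval x P)^* = zeval (x^* : C) P.
Proof.
rewrite !(@zeval_sum _ _ _ (size P)) // rmorph_sum /=; apply: eq_bigr => i _.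
by rewrite rmorphM rmorphXn /= rmorph_int.
Qed.

Lemma zeval_compX_pred k (P : {poly int}) :
  zeval (z ^+ k) (P \Po 'X^(m.-1)) = (zeval (z ^+ k) P)^*.
Proof. by rewrite zeval_compXn expz_pred zeval_conj. Qed.

Let co2 i : coprime (2 ^ i) m.
Proof. by rewrite coprimeXl // coprime2n. Qed.

Let G_gal k : coprime k m ->
  zeval (z ^+ k) (\sum_(j < p) (legendre p j)%:P * 'X^(p ^ e * j)) = (legendre p k)%:~R * G.
Proof.
rewrite /m coprime_pexpr // coprime_sym prime_coprime // => pk.
rewrite -(gauss_sum_scale p_pr p_mod4 prim_w pk) rmorph_sum /=.
apply: eq_bigr => j _; rewrite rmorphM /= zevalC zevalXn exprM; congr (_ * _ ^+ _).
by rewrite exprAC.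
Qed.

Let leg_mod i j : (i = j %[mod m])%N -> legendre p i = legendre p j.
Proof.
move=> E; rewrite -legendre_mod -[RHS]legendre_mod.
have p_dv_m : (p %| m)%N by rewrite /m expnS dvdn_mulr.
by rewrite -(modn_dvdm i p_dv_m) E modn_dvdm.
Qed.

Let leg1 : legendre p 1 = 1.
Proof. by rewrite /legendre dvdn1 exp1n eqxx; case: eqP => // p1; move: p_gt2; rewrite p1. Qed.

Let legX c i : legendre p (c ^ i) = legendre p c ^+ i.
Proof. by elim: i => [|i IH]; rewrite ?expn0 ?leg1 // expnS legendreM // IH exprS. Qed.

(** The symbol of 2 has d-th power 1 with d odd, which excludes 0 and -1. *)
Let leg2 i : legendre p (2 ^ i) = 1.
Proof.
suff l2 : legendre p 2 = 1 by rewrite legX l2 expr1n.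
have := leg_mod ord2; rewrite legX leg1; have [->|->|->] := legendre_values p 2 => //.
  by rewrite expr0n; case: (d) d_odd.
by rewrite -signr_odd d_odd.
Qed.

Let leg_opp : legendre p m.-1 = -1.
Proof.
rewrite -(legendre_opp p_pr p_mod4) -legendre_mod -[RHS]legendre_mod; congr legendre.
have -> : m.-1 = ((p ^ e).-1 * p + p.-1)%N.
  have : (0 < p ^ e)%N by rewrite expn_gt0 prime_gt0.
  rewrite /m expnS; case: (p ^ e)%N => // n _.
  by rewrite mulnC mulSn /=; clear -p_gt2; lia.
by rewrite modnMDl.
Qed.

Lemma quadratic_descent t (P : {poly int}) : zeval z P * (zeval z P)^* = 2 ^+ t ->
  exists j (a b : int), a ^+ 2 + p%:Z * b ^+ 2 = 2 ^+ t.+2 /\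
    2 * zeval z P = z ^+ j * (a%:~R + b%:~R * G).
Proof.
move=> normP; pose Pc := P \Po 'X^(m.-1).
have gal := zeval_galois_eq prim_z.
have conj1 : zeval z Pc = (zeval z P)^*.
  by have := zeval_compX_pred 1 P; rewrite expr1.
have norm_gal k : coprime k m -> zeval (z ^+ k) P * (zeval (z ^+ k) P)^* = 2 ^+ t.
  move=> co; have := gal (P * Pc) (2 ^+ t) k co.
  rewrite !rmorphM !rmorphXn /= !rmorph_nat conj1 zeval_compX_pred; exact.
have [X DX] : exists X, zeval z (P \Po 'X^2) = zeval z (X * P).
  have [a [b Dab]] := frobenius_stable prim_z m_odd (odd_gt0 d_odd) ord2z t P.
  exists (a + b * Pc); rewrite zeval_compXn Dab -normP rmorphM rmorphD rmorphM /=.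
  by rewrite conj1; ring.
have co2k k : coprime k m -> coprime (2 * k) m by move=> co; rewrite coprimeMl coprime2n m_odd.
have zeval2 k (Q : {poly int}) : zeval (z ^+ k) (Q \Po 'X^2) = zeval (z ^+ (2 * k)) Q.
  by rewrite zeval_compXn -exprM mulnC.
have [s [j Dj]] : exists (s : bool) j, zeval z X = (-1) ^+ s * z ^+ j.
  apply: (unit_modulus_root_of_unity p_pr p_gt2 prim_z) => k co.
  have := norm_gal _ (co2k _ co); rewrite -zeval2 (gal _ _ _ co DX) rmorphM /=.
  rewrite rmorphM mulrACA norm_gal // -normCK => /eqP.
  rewrite -subr_eq0 -{2}[2 ^+ t]mul1r -mulrBl mulf_eq0 expf_eq0 pnatr_eq0 andbF orbF.
  by rewrite subr_eq0 pexpr_eq1 // => /eqP.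
(* Division by z^j, since z^(m-1) is the inverse of z. Squaring z multiplies z^j by z^j, exactly the
   factor gained by F, so the same j makes g invariant up to sign. *)
pose P' := P * 'X^(m.-1 * j); pose g := zeval z P'.
have zjV : z ^+ j * z ^+ (m.-1 * j) = 1.
  by rewrite -exprD -mulSn prednK // exprM zm expr1n.
have step k : coprime k m -> zeval (z ^+ (2 * k)) P' = (-1) ^+ s * zeval (z ^+ k) P'.
  move=> co; rewrite -zeval2.
  have sgn x (Q : {poly int}) : (-1) ^+ s * zeval (x : C) Q = zeval x ((-1) ^+ s * Q).
    by rewrite rmorphM rmorphXn rmorphN rmorph1.
  rewrite sgn; apply: gal => //; rewrite comp_polyM rmorphM /= DX -sgn !rmorphM /=.
  rewrite comp_Xn_poly -exprM !zevalXn Dj mulnC exprM expr2.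
  by rewrite -[RHS]mulr1 -zjV; ring.
have iter i : zeval (z ^+ (2 ^ i)) P' = (-1) ^+ (s * i) * g.
  elim: i => [|i IH]; first by rewrite muln0 expr0 mul1r expr1.
  by rewrite expnS step // IH mulrA -exprD mulnS.
have g_neq0 : g != 0.
  apply: contraTneq isT => g0; have : zeval z P = 0.
    apply/eqP; move/eqP: g0; rewrite /g rmorphM /= zevalXn mulf_eq0.
    by rewrite (negbTE (expf_neq0 _ z_neq0)) orbF.
  move=> P0; move/eqP: normP; rewrite P0 mul0r eq_sym expf_eq0 pnatr_eq0.
  by rewrite andbF.
have s0 : s = false.
  have := iter d; rewrite ord2z -/g -{1}[g]mul1r => /(mulIf g_neq0).
  case: (s) => //; rewrite mul1n -signr_odd d_odd expr1 => /eqP.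
  by rewrite eq_sym eqNr oner_eq0.
have gfix i : zeval (z ^+ (2 ^ i)) P' = g by rewrite iter s0 mul0n expr0 mul1r.
have normg : g * g^* = 2 ^+ t.
  rewrite -normP /g rmorphM /= zevalXn rmorphM /= mulrACA.
  rewrite [(z ^+ _)^*](@conj_unity_root _ m) ?divff ?expf_neq0 ?mulr1 //.
  by rewrite exprAC zm expr1n.
have galgen k : coprime k m ->
    (zeval (z ^+ k) P' = g /\ (legendre p k)%:~R * G = G) \/
    (zeval (z ^+ k) P' = g^* /\ (legendre p k)%:~R * G = - G).
  move=> co; have [i [E|E]] := gen2 co; [left | right]; rewrite (expz_mod E).
    by rewrite gfix (leg_mod E) leg2 mul1r.
  rewrite mulnC exprM expz_pred -zeval_conj gfix (leg_mod E) legendreM // leg2 mulr1.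
  by rewrite leg_opp mulN1r.
have [a Da] : exists a : int, g + g^* = a%:~R.
  apply: (zeval_fixed_int prim_z (Q := P' + (P' \Po 'X^(m.-1)))) => k co.
  rewrite rmorphD /= zeval_compX_pred.
  by case: (galgen k co) => -[-> _] //; rewrite conjCK addrC.
(* Both factors change sign under -1 and are fixed under 2, so the product is rational. With G^2 =
   -p its square is p (2^(t+2) - a^2); hence p divides c, and dividing by G puts the minus sign in
   the witness for b. *)
have [c Dc] : exists c : int, (g - g^*) * G = c%:~R.
  apply: (zeval_fixed_int prim_z (Q := (P' - (P' \Po 'X^(m.-1))) *
     \sum_(j < p) (legendre p j)%:P * 'X^(p ^ e * j))) => k co.
  rewrite rmorphM rmorphB /= zeval_compX_pred G_gal //.
  by case: (galgen k co) => -[-> ->] //; rewrite conjCK; ring.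
have G2 : G ^+ 2 = - p%:R by exact: gauss_sum_sqr.
have Ec : c ^+ 2 = p%:Z * (2 ^+ t.+2 - a ^+ 2).
  apply: (@intr_inj C); rewrite [RHS]rmorphM /= rmorphB /= !rmorphXn /= -Dc -Da exprMn G2.
  by rewrite !exprS -normg -pmulrn; ring.
have [b' Db] : exists b', c = b' * p%:Z.
  apply/dvdzP; have : (p%:Z %| c ^+ 2)%Z by rewrite Ec dvdz_mulr.
  by rewrite !dvdzE !absz_nat abszX Euclid_dvdX // => /andP[].
have p0 : p%:R != 0 :> C by rewrite pnatr_eq0 -lt0n prime_gt0.
exists j, a, (- b'); split.
  have : p%:Z * (b' ^+ 2 * p%:Z) = p%:Z * (2 ^+ t.+2 - a ^+ 2).
    by rewrite -Ec Db; ring.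
  have pZ0 : p%:Z != 0 by rewrite eqz_nat -lt0n prime_gt0.
  by move/(mulfI pZ0) => E; rewrite sqrrN [p%:Z * _]mulrC E addrC subrK.
have Dg : g - g^* = - (b'%:~R * G).
  apply: (mulIf p0).
  have : (g - g^*) * G * G = c%:~R * G by rewrite Dc.
  rewrite -mulrA -expr2 G2 Db rmorphM /= -pmulrn => E.
  by apply: oppr_inj; rewrite -[LHS]mulrN E; ring.
rewrite rmorphN /= mulNr -Da -Dg.
have -> : zeval z P = z ^+ j * g.
  by rewrite /g rmorphM /= zevalXn mulrCA zjV mulr1.
by ring.
Qed.
End Descent.

(** * The prime above 2 in the imaginary quadratic field *)

(** An alias recording p, on which the multiplication depends; addition stays componentwise. *)
Definition OKring (p : nat) : Type := OK.

HB.instance Definition _ p := GRing.Zmodule.copy (OKring p) (int * int)%type.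

Section OKring.
Variable p : nat.
Local Notation A := (OKring p).
Let k : int := ((p.+1) %/ 4)%N%:Z.

Let one : A := (1, 0).
Let mul : A -> A -> A := @OKmul p.

Fact OKmulA : associative mul.
Proof. by move=> [a b] [c d] [e f]; rewrite /mul /OKmul /=; congr pair; ring. Qed.
Fact OKmulC : commutative mul.
Proof. by move=> [a b] [c d]; rewrite /mul /OKmul /=; congr pair; ring. Qed.
Fact OKmul1 : left_id one mul.
Proof. by move=> [a b]; rewrite /mul /OKmul /=; congr pair; ring. Qed.
Fact OKmulDl : left_distributive mul +%R.
Proof.
have addE (x y : A) : x + y = (x.1 + y.1, x.2 + y.2) by [].
by move=> [a b] [c d] [e f]; rewrite !addE /mul /OKmul /=; congr pair; ring.
Qed.
Fact OKone_neq0 : one != 0.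
Proof. by []. Qed.

HB.instance Definition _ := GRing.Zmodule_isComNzRing.Build A
  OKmulA OKmulC OKmul1 OKmulDl OKone_neq0.

Lemma OKmulE (x y : A) : OKmul p x y = x * y. Proof. by []. Qed.
Lemma OKaddE (x y : A) : OKadd x y = x + y. Proof. by []. Qed.

Lemma OK_natE n : (n%:R : A) = (n%:Z, 0).
Proof.
elim: n => [|n IH]; first by [].
by rewrite -addn1 natrD IH; congr pair; lia.
Qed.

Lemma OK_2X s : (2 ^+ s : A) = (2 ^+ s : int, 0).
Proof. by rewrite -natrX OK_natE -natz natrX. Qed.

Lemma OK_mul2 (x : A) : 2 * x = (2 * x.1, 2 * x.2).
Proof. by rewrite OK_natE -OKmulE /OKmul /=; congr pair; ring. Qed.

Lemma OK_mul2I : injective ( *%R (2 : A)).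
Proof. by move=> [a b] [c d]; rewrite !OK_mul2 /= => -[E1 E2]; congr pair; lia. Qed.

Lemma OK_mul2XI s : injective ( *%R (2 ^+ s : A)).
Proof.
elim: s => [|s IH] x y; first by rewrite !mul1r.
by rewrite exprS -!mulrA => /OK_mul2I/IH.
Qed.

Definition OKconj (x : A) : A := (x.1 + x.2, - x.2).
Definition OKnorm (x : A) : int := x.1 ^+ 2 + x.1 * x.2 + k * x.2 ^+ 2.
Definition OKw : A := (0, 1).

Lemma OK_normE x : x * OKconj x = (OKnorm x, 0).
Proof.
by case: x => a b; rewrite -OKmulE /OKmul /OKconj /OKnorm /=; congr pair; rewrite -/k; ring.
Qed.

Lemma OK_normM x y : OKnorm (x * y) = OKnorm x * OKnorm y.
Proof.
by case: x y => [a b] [c d]; rewrite -OKmulE /OKmul /OKnorm /= -/k; ring.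
Qed.

Hypothesis p_mod8 : (p = 7 %[mod 8])%N.

Let kE : 4 * k = p%:Z + 1. Proof. rewrite /k; move: p_mod8; lia. Qed.
Let k_even : exists k', k = 2 * k'.
Proof. by exists (k %/ 2)%Z; rewrite /k; move: p_mod8; lia. Qed.

(** Converts elements of norm 2^s into solutions of a^2 + p b^2 = 2^(s+2), and back. *)
Lemma OK_norm4 x : 4 * OKnorm x = (2 * x.1 + x.2) ^+ 2 + p%:Z * x.2 ^+ 2.
Proof.
rewrite /OKnorm; have -> : p%:Z = 4 * k - 1 by rewrite kE; ring.
by ring.
Qed.

Lemma OK_norm_ge0 x : 0 <= OKnorm x.
Proof.
rewrite -(pmulr_rge0 _ (ltr0n _ 4)) OK_norm4.
by apply: addr_ge0; [exact: sqr_ge0 | apply: mulr_ge0 => //; exact: sqr_ge0].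
Qed.

(* [in_p2 x] and [in_p2c x] say that [x] lies in (2, w), resp. in its conjugate;
   both are kernels of ring morphisms onto the field with two elements. *)
Definition in_p2 (x : A) := (2 %| x.1)%Z.
Definition in_p2c (x : A) := (2 %| x.1 + x.2)%Z.

Let dvd2M (a b : int) : (2 %| a * b)%Z = (2 %| a)%Z || (2 %| b)%Z.
Proof. by rewrite !dvdzE abszM Euclid_dvdM. Qed.

Lemma in_p2M x y : in_p2 (x * y) = in_p2 x || in_p2 y.
Proof.
have [k' Dk] := k_even; rewrite /in_p2 -dvd2M -OKmulE /= -/k Dk -mulrA.
by rewrite -mulrN rpredDr //; exact: dvdz_mulr.
Qed.

Lemma in_p2cM x y : in_p2c (x * y) = in_p2c x || in_p2c y.
Proof.
have [k' Dk] := k_even; rewrite /in_p2c -dvd2M -OKmulE /= -/k Dk.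
have -> : x.1 * y.1 - 2 * k' * (x.2 * y.2) + (x.1 * y.2 + x.2 * y.1 + x.2 * y.2) =
  (x.1 + x.2) * (y.1 + y.2) + 2 * (- k' * (x.2 * y.2)) by ring.
by rewrite rpredDr // dvdz_mulr.
Qed.

Lemma in_p2X x n : in_p2 (x ^+ n) = (0 < n)%N && in_p2 x.
Proof. by elim: n => // n IH; rewrite exprS in_p2M IH; case: n {IH} => [|n]; case: in_p2. Qed.

Lemma in_p2cX x n : in_p2c (x ^+ n) = (0 < n)%N && in_p2c x.
Proof. by elim: n => // n IH; rewrite exprS in_p2cM IH; case: n {IH} => [|n]; case: in_p2c. Qed.

Lemma dvd2_OK x : in_p2 x -> in_p2c x -> exists y, x = 2 * y.
Proof.
case: x => a b; rewrite /in_p2 /in_p2c /= => /dvdzP[c ->] /dvdzP[d Dd].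
by exists (c, d - c); rewrite OK_mul2 /=; congr pair; lia.
Qed.

Lemma in_p2_mul2 x : in_p2 (2 * x).
Proof. by rewrite OK_mul2 /in_p2 /= dvdz_mulr. Qed.

Lemma in_p2c_mul2 x : in_p2c (2 * x).
Proof. by rewrite OK_mul2 /in_p2c /= -mulrDr dvdz_mulr. Qed.

(** A local test for divisibility by 2^s: u is invertible at (2, w) and v at the conjugate prime,
    and 2 is the product of the two primes. *)
Lemma dvd2X_OK s x u v : ~~ in_p2 u -> ~~ in_p2c v ->
  (exists h, x * u = 2 ^+ s * h) -> (exists h, x * v = 2 ^+ s * h) ->
  exists h, x = 2 ^+ s * h.
Proof.
move=> u_unit v_unit; elim: s => [|s IH] [hu Hu] [hv Hv].
  by exists x; rewrite expr0 mul1r.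
have [y Dy] : exists y, x = 2 ^+ s * y.
  by apply: IH; [exists (2 * hu); rewrite Hu | exists (2 * hv); rewrite Hv];
     rewrite exprS; ring.
have yu : y * u = 2 * hu.
  by apply: (@OK_mul2XI s); rewrite mulrA -Dy Hu exprS; ring.
have yv : y * v = 2 * hv.
  by apply: (@OK_mul2XI s); rewrite mulrA -Dy Hv exprS; ring.
have [||y' Dy'] := @dvd2_OK y.
- by have := in_p2_mul2 hu; rewrite -yu in_p2M (negbTE u_unit) orbF.
- by have := in_p2c_mul2 hv; rewrite -yv in_p2cM (negbTE v_unit) orbF.
by exists y'; rewrite Dy Dy' exprS; ring.
Qed.

Definition is_ideal (I : A -> Prop) :=
  [/\ I 0, forall x y, I x -> I y -> I (x + y) & forall r x, I x -> I (r * x)].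

Lemma gen_ideal_min (S J : A -> Prop) : is_ideal J -> (forall x, S x -> J x) ->
  forall x, gen_ideal p S x -> J x.
Proof.
move=> [J0 JD JM] SJ x [s [+ ->]]; elim: s => [|c s IH] Ss //=.
apply: JD; first by apply/JM/SJ/Ss; rewrite mem_head.
by apply: IH => c' sc'; apply: Ss; rewrite inE sc' orbT.
Qed.

Lemma gen_ideal_gen (S : A -> Prop) x : S x -> gen_ideal p S x.
Proof.
move=> Sx; exists [:: ((1 : A) : OK, x : OK)]; split=> [c|].
  by rewrite inE => /eqP->.
by rewrite /= OKmulE OKaddE mul1r addr0.
Qed.

Lemma gen_ideal_ideal (S : A -> Prop) : is_ideal (gen_ideal p S).
Proof.
split; first by exists [::].
- move=> x y [s [Ss ->]] [s' [Ss' ->]]; exists (s ++ s'); split=> [c|].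
    by rewrite mem_cat => /orP[/Ss|/Ss'].
  rewrite foldr_cat; elim: s {Ss} => [|c s IH] /=; first by rewrite add0r.
  by rewrite !OKaddE -IH addrA.
move=> r x [s [Ss ->]].
exists [seq ((r * (c.1 : A) : A) : OK, c.2) | c <- s]; split=> [c|].
  by case/mapP=> c' /Ss ? ->.
elim: s {Ss} => [|c s IH] /=; first by rewrite mulr0.
by rewrite !OKaddE -IH !OKmulE mulrDr mulrA.
Qed.

Local Notation I := (ideal_pow p (p2 p)).

Lemma ideal_pow_ideal s : is_ideal (I s).
Proof. by case: s => [|s]; exact: gen_ideal_ideal. Qed.

Lemma p2_2 : p2 p (2 : A).
Proof. by apply: gen_ideal_gen; left; rewrite OK_natE. Qed.

Lemma p2_w : p2 p OKw.
Proof. by apply: gen_ideal_gen; right. Qed.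

Lemma ideal_powX (x : A) s : p2 p x -> I s (x ^+ s).
Proof.
move=> px; elim: s => [|s IH]; first exact: gen_ideal_gen.
apply: gen_ideal_gen; exists x, (x ^+ s).
by split=> //; split=> //; rewrite OKmulE exprS.
Qed.

Lemma OKw_conj : OKw + OKconj OKw = 1.
Proof. by []. Qed.

Lemma OKw_norm : exists k', OKw * OKconj OKw = 2 * (k' : A).
Proof.
have [k' Dk] := k_even; exists (k', 0); rewrite OK_mul2 OK_normE /OKnorm /=.
by congr pair; rewrite Dk; ring.
Qed.

(** Both generators 2 and w become multiples of 2 when multiplied by the conjugate of w, since w has
    even norm (p + 1)/4. *)
Lemma ideal_pow_conj s x : I s x -> exists h : A, (x : A) * OKconj OKw ^+ s = 2 ^+ s * h.
Proof.
have ideal_mulR n (c : A) : is_ideal (fun x : A => exists h : A, x * c = 2 ^+ n * h).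
  split; first by exists 0; rewrite mul0r mulr0.
    by move=> a b [h Dh] [h' Dh']; exists (h + h'); rewrite mulrDl Dh Dh' mulrDr.
  by move=> r a [h Dh]; exists (r * h); rewrite -mulrA Dh mulrCA.
elim: s x => [|s IH] x Ix; first by exists (x : A); rewrite !expr0 mulrC.
move: x Ix; apply: gen_ideal_min => // _ [a [b [pa [Ib ->]]]].
have [h Dh] := IH b Ib.
have [h' Dh'] : exists h', (a : A) * OKconj OKw = 2 ^+ 1 * h'.
  move: a pa; apply: gen_ideal_min => // _ [->|->].
    by exists (OKconj OKw); rewrite expr1 OK_natE.
  by have [h' Dh'] := OKw_norm; exists h'.
by exists (h' * h); rewrite OKmulE !exprS mulrACA Dh Dh' expr1 mulrACA.
Qed.

Lemma comaximalX (R : comNzRingType) (x y : R) i j : x + y = 1 ->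
  exists a b, 1 = a * x ^+ i + b * y ^+ j.
Proof.
move=> xy; elim: i => [|i [a [b IH]]]; first by exists 1, 0; rewrite expr0; ring.
have [c [d Dcd]] : exists c d, 1 = c * x + d * y ^+ j.
  elim: j {a b IH} => [|j [c [d IH]]]; first by exists 0, 1; rewrite expr0; ring.
  by exists (1 + c * y), d; rewrite -{1}xy -{1}[y]mulr1 {1}IH exprS; ring.
exists (a * c), (a * x ^+ i * d + b).
by rewrite {1}IH -[a * x ^+ i]mulr1 {1}Dcd exprS; ring.
Qed.

(** With a = 2c + b, the element c + b w has norm 2^s. Since b is odd like a, it lies in exactly one
    of the two primes above 2, and up to conjugation this is (2, w); it then generates the s-th
    power. *)
Lemma principal_of_odd_solution s (a b : int) : (0 < s)%N ->
  a ^+ 2 + p%:Z * b ^+ 2 = 2 ^+ s.+2 -> ~~ (2 %| a)%Z -> principal p (I s).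
Proof.
move=> s_gt0 Eab a_odd.
have [g [Ng g_p2 g_p2c]] : exists g : A,
    [/\ OKnorm g = 2 ^+ s, in_p2 g & ~~ in_p2c g].
  have : exists c : int, a = 2 * c + b.
    exists ((a - b) %/ 2)%Z; have: (2 %| a - b)%Z; last by lia.
    have : (2 %| a ^+ 2 + p%:Z * b ^+ 2)%Z by rewrite Eab exprS dvdz_mulr.
    have -> : p%:Z * b ^+ 2 = b ^+ 2 + 2 * ((p%:Z - 1) %/ 2)%Z * b ^+ 2.
      have Dp : p%:Z = 1 + 2 * ((p%:Z - 1) %/ 2)%Z by move: p_mod8; lia.
      by rewrite {1}Dp; ring.
    rewrite addrA -mulrA rpredDr; last exact: dvdz_mulr.
    have -> : a ^+ 2 + b ^+ 2 = (a - b) ^+ 2 + 2 * (a * b) by ring.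
    by rewrite rpredDr; [rewrite expr2 dvd2M orbb | exact: dvdz_mulr].
  case=> c Da.
  have Ng : OKnorm (c, b) = 2 ^+ s.
    apply: (@mulfI _ 4) => //; rewrite OK_norm4 /= -Da Eab !exprS; ring.
  have b_odd : ~~ (2 %| b)%Z by move: a_odd; rewrite Da; lia.
  have [ev|od] := boolP (2 %| c)%Z.
    by exists (c, b); split; rewrite // /in_p2c /=; lia.
  exists (c + b, - b); split.
  - by rewrite -Ng /OKnorm /=; ring.
  - by rewrite /in_p2 /=; lia.
  by rewrite /in_p2c /=; lia.
have gc_p2 : ~~ in_p2 (OKconj g) by [].
have gg : g * OKconj g = 2 ^+ s.
  by rewrite OK_normE Ng OK_2X.
have wbar : ~~ in_p2 (OKconj OKw ^+ s) by rewrite in_p2X s_gt0.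
exists g => x; split=> [Ix|[r ->]].
  have [h Dh] := ideal_pow_conj Ix.
  (* As 2^s = g conj g, membership of x in (g) amounts to 2^s dividing x conj g; this is tested at
     the two primes with the powers of conj w and with g. *)
  have [r Dr] : exists r, (x : A) * OKconj g = 2 ^+ s * r.
    apply: (dvd2X_OK wbar g_p2c).
      by exists (h * OKconj g); rewrite mulrAC Dh mulrA.
    by exists x; rewrite -mulrA [_ * g]mulrC gg mulrC.
  exists r; apply: (@OK_mul2XI s).
  by rewrite OKmulE mulrA -Dr -mulrA [_ * g]mulrC gg mulrC.
have [I0 ID IM] := ideal_pow_ideal s; apply: (IM r).
(* From w + conj w = 1, g is a combination of g w^s and g (conj w)^s; the first lies in the ideal
   through w^s, the second is a multiple of 2^s. *)
have [c [d Dcd]] := comaximalX s s OKw_conj.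
have [h Dh] : exists h, OKconj OKw ^+ s * g = 2 ^+ s * h.
  apply: (dvd2X_OK gc_p2 (v := OKw ^+ s)); first by rewrite in_p2cX s_gt0.
    by exists (OKconj OKw ^+ s); rewrite -mulrA gg mulrC.
  have [k' Dk'] := OKw_norm; exists (k' ^+ s * g).
  by rewrite mulrAC -exprMn [OKconj _ * _]mulrC Dk' exprMn mulrA.
have -> : g = c * g * OKw ^+ s + d * h * 2 ^+ s.
  by rewrite -{1}[g]mul1r {1}Dcd mulrDl -!mulrA Dh; ring.
by apply: ID; apply: IM; apply: ideal_powX; [exact: p2_w | exact: p2_2].
Qed.

(** A generator g divides 2^t, so its norm is a power of 2, and divides w^t, so it avoids the
    conjugate prime. Once the norm is known to be 2^t, completing the square gives the solution, odd
    because g lies in only one of the two primes. *)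
Lemma odd_solution_of_principal t : (0 < t)%N -> principal p (I t) ->
  exists a b : int, a ^+ 2 + p%:Z * b ^+ 2 = 2 ^+ t.+2 /\ ~~ (2 %| a)%Z.
Proof.
move=> t_gt0 [g Dg].
have gI : I t g by apply/Dg; exists (1 : A); rewrite OKmulE mul1r.
have [r Dr] : exists r : A, 2 ^+ t = r * (g : A).
  by have /Dg[r Dr] := ideal_powX t p2_2; exists r.
have [r' Dr'] : exists r : A, OKw ^+ t = r * (g : A).
  by have /Dg[r' Dr'] := ideal_powX t p2_w; exists r'.
have [h Dh] := ideal_pow_conj gI.
have g_p2c : ~~ in_p2c g.
  have : ~~ in_p2c (OKw ^+ t) by rewrite in_p2cX t_gt0.
  by rewrite Dr' in_p2cM negb_or => /andP[].
have g_p2 : in_p2 g.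
  have : in_p2 (2 ^+ t * h) by rewrite -(prednK t_gt0) exprS -mulrA in_p2_mul2.
  by rewrite -Dh in_p2M in_p2X t_gt0 orbF.
have [s Ns] : exists s, OKnorm g = 2 ^+ s.
  have : (`|OKnorm g| %| 2 ^ (2 * t))%N.
    have := congr1 OKnorm Dr; rewrite OK_normM OK_2X /OKnorm /= -/(OKnorm g).
    rewrite mulr0 addr0 expr0n mulr0 addr0 -exprM mulnC => /(congr1 absz).
    by rewrite abszX abszM => ->; rewrite dvdn_mull.
  case/(dvdn_pfactor _ _ (isT : prime 2))=> s _ Ds; exists s.
  by rewrite -[LHS]gez0_abs ?OK_norm_ge0 // Ds -natz natrX natz.
have gg : (g : A) * OKconj g = 2 ^+ s.
  by rewrite OK_normE Ns OK_2X.
(* If s > t, then 2 divides conj g, so g lies in the conjugate prime; if s < t, then 2 divides a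
   power of conj w, which is not in (2, w). *)
have Est : s = t.
  apply/eqP; rewrite eqn_leq; apply/andP; split; rewrite leqNgt; apply/negP => lt.
    have : OKconj g = 2 ^+ (s - t) * r.
      apply: (@OK_mul2XI t); rewrite mulrA -exprD subnKC 1?ltnW //.
      by rewrite Dr -mulrA gg mulrC.
    rewrite -(prednK (n := s - t)) ?subn_gt0 // exprS -mulrA => E.
    by have := in_p2_mul2 (2 ^+ (s - t).-1 * r); rewrite -E; apply/negP.
  have : OKconj OKw ^+ t = 2 ^+ (t - s) * (h * OKconj g).
    apply: (@OK_mul2XI s); rewrite [RHS]mulrA -exprD subnKC 1?ltnW //.
    by rewrite mulrA -Dh -gg mulrAC.
  rewrite -(prednK (n := t - s)) ?subn_gt0 // exprS -mulrA => E.
  by have := in_p2_mul2 (2 ^+ (t - s).-1 * (h * OKconj g)); rewrite -E in_p2X t_gt0.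
exists (2 * g.1 + g.2), g.2; split.
  by rewrite -OK_norm4 Ns Est !exprS; ring.
by move: g_p2 g_p2c; rewrite /in_p2 /in_p2c; lia.
Qed.
End OKring.

(** * Solutions of a^2 + p b^2 = 2^(t+2) for the minimal exponent t *)

(** The root is g = gcd(u, b): with u = u1 g and b = b1 g one gets u1 v = g b1^2, and coprimality
    makes u1 and g divide each other. *)
Lemma square_of_coprime_mul (u v b : nat) :
  coprime u v -> (u * v = b ^ 2)%N -> exists c, (u = c ^ 2)%N.
Proof.
move=> co E; have [u0|u_gt0] := posnP u; first by exists 0%N; rewrite u0.
pose g := gcdn u b; have g_gt0 : (0 < g)%N by rewrite gcdn_gt0 u_gt0.
have [/dvdnP[u1 Du] /dvdnP[b1 Db]] : (g %| u)%N /\ (g %| b)%N.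
  by rewrite dvdn_gcdl dvdn_gcdr.
have co1 : coprime u1 b1.
  have : gcdn (u1 * g) (b1 * g) = g by rewrite -Du -Db.
  by rewrite -muln_gcdl -{2}[g]mul1n => /eqP; rewrite eqn_pmul2r.
have E1 : (u1 * v = g * b1 ^ 2)%N.
  apply/eqP; rewrite -(eqn_pmul2l g_gt0); apply/eqP.
  by move: E; rewrite Du Db -!mulnn; nia.
have cogv : coprime g v by move: co; rewrite Du coprimeMl => /andP[].
suff E2 : u1 = g by exists g; rewrite Du E2 mulnn.
apply/eqP; rewrite eqn_dvd.
rewrite -(@Gauss_dvdl u1 g (b1 ^ 2)) ?coprimeXr // -E1 dvdn_mulr //=.
by rewrite -(@Gauss_dvdl g u1 v) // E1 dvdn_mulr.
Qed.

(* Factor p y^2 = (M - x)(M + x) into coprime factors. *)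
Lemma odd_solution_half (p x y M : nat) : prime p -> odd x -> ~~ odd M ->
  coprime M x -> (x ^ 2 + p * y ^ 2 = M ^ 2)%N ->
  exists c d, odd d /\ (d ^ 2 + p * c ^ 2 = 2 * M)%N.
Proof.
move=> p_pr x_odd M_even coMx Exy.
have y_gt0 : (0 < y)%N.
  rewrite lt0n; apply: contraTneq x_odd => y0.
  have : odd (x ^ 2) = odd (M ^ 2) by rewrite -Exy y0 muln0 addn0.
  by rewrite !oddX /= => ->.
have lt_xM : (x < M)%N.
  rewrite -(ltn_exp2r _ _ (isT : (0 < 2)%N)) -Exy -[X in (X < _)%N]addn0 ltn_add2l.
  by rewrite muln_gt0 prime_gt0 // expn_gt0 y_gt0.
have le_xM := ltnW lt_xM.
have UV : ((M - x) * (M + x) = p * y ^ 2)%N by rewrite -subn_sqr -Exy addKn.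
have oddU : odd (M - x) by rewrite oddB // (negbTE M_even) x_odd.
have oddV : odd (M + x) by rewrite oddD (negbTE M_even) x_odd.
have co : coprime (M - x) (M + x).
  have -> : (M + x = (M - x) + 2 * x)%N by clear -le_xM; lia.
  rewrite /coprime gcdnDl -/(coprime _ _) coprimeMr coprimen2 oddU /=.
  by rewrite coprime_sym /coprime -(gcdnDr x) subnK // gcdnC.
have sumUV : ((M - x) + (M + x) = 2 * M)%N by clear -le_xM; lia.
(* Stated for a pair U, V because p may divide either factor; then U = p c^2 and V = d^2. *)
have key (U V : nat) : coprime U V -> odd V -> (U + V = 2 * M)%N ->
    (U * V = p * y ^ 2)%N -> (p %| U)%N ->
    exists c d, odd d /\ (d ^ 2 + p * c ^ 2 = 2 * M)%N.
  move=> coUV Vodd sUV mUV /dvdnP[U' DU].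
  have mUV' : (U' * V = y ^ 2)%N.
    by apply/eqP; rewrite -(eqn_pmul2l (prime_gt0 p_pr)) -mUV DU mulnA [(p * _)%N]mulnC.
  have coU' : coprime U' V by move: coUV; rewrite DU coprimeMl => /andP[].
  have [c Dc] := square_of_coprime_mul coU' mUV'.
  have [d Dd] : exists d, (V = d ^ 2)%N.
    by apply: (@square_of_coprime_mul V U' y); rewrite 1?coprime_sym // mulnC.
  exists c, d; split; first by move: Vodd; rewrite Dd oddX.
  by rewrite -Dd -Dc addnC [(p * _)%N]mulnC -DU.
have : (p %| (M - x) * (M + x))%N by rewrite UV dvdn_mulr.
rewrite Euclid_dvdM // => /orP[]; first exact: (key (M - x)%N (M + x)%N).
apply: (key (M + x)%N (M - x)%N) => //; first by rewrite coprime_sym.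
  by rewrite addnC.
by rewrite mulnC.
Qed.

Lemma sqr_neq2 (x : int) : x ^+ 2 <> 2.
Proof.
move/(congr1 absz); rewrite abszX; case: `|x|%N => [|[|n]] //.
by clear; rewrite -mulnn; nia.
Qed.

Section MinimalExponent.
Variables p t : nat.
Hypotheses (p_pr : prime p) (p_mod8 : (p = 7 %[mod 8])%N) (tp : is_tp p t).

Let t_gt0 : (0 < t)%N. Proof. by case: tp. Qed.
Let p_ge7 : (7 <= p)%N. Proof. by move: p_mod8 (prime_gt0 p_pr); lia. Qed.
Let p_odd : odd p. Proof. by move: p_mod8; lia. Qed.

Lemma tp_no_smaller_solution s (a b : int) : (0 < s < t)%N ->
  a ^+ 2 + p%:Z * b ^+ 2 = 2 ^+ s.+2 -> (2 %| a)%Z.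
Proof.
move=> lt_s E; apply: contraT => a_odd; case: tp => _ [_ /(_ s lt_s)[]].
by apply: (principal_of_odd_solution p_mod8 _ E a_odd); case/andP: lt_s.
Qed.

(** For t = 2q the right-hand side is the square of 2^(q+1), and factoring the difference of squares
    yields an odd solution with exponent q, against minimality. *)
Lemma tp_odd : odd t.
Proof.
apply: contraT => t_even; have [q Dt] : exists q, t = (q * 2)%N.
  by exists t./2; lia.
have q_gt0 : (0 < q)%N by lia.
have lt_q : (0 < q < t)%N by lia.
have [_ [princ _]] := tp; have [a [b [E a_odd]]] := odd_solution_of_principal p_mod8 t_gt0 princ.
pose x := `|a|%N; pose y := `|b|%N; pose M := (2 ^ q.+1)%N.
have x_odd : odd x by move: a_odd; rewrite dvdzE dvdn2 negbK.
have coMx : coprime M x by rewrite /M coprimeXl // coprime2n.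
have M_even : ~~ odd M by rewrite /M oddX.
have sqE (n : nat) : (n ^ 2)%N%:Z = n%:Z ^+ 2 by rewrite -mulnn PoszM.
have {E} Exy : (x ^ 2 + p * y ^ 2 = M ^ 2)%N.
  apply/eqP; rewrite -eqz_nat PoszD PoszM; apply/eqP.
  rewrite !sqE !abszE !real_normK ?num_real // E Dt -sqE -natz /M -expnM natrX.
  by rewrite mulSn addnC addn2.
have [c [d [d_odd Ed]]] := odd_solution_half p_pr x_odd M_even coMx Exy.
suff : (2 %| d%:Z)%Z by rewrite dvdzE dvdn2 d_odd.
apply: (@tp_no_smaller_solution q d%:Z c%:Z lt_q).
by rewrite -!sqE -PoszM -PoszD Ed /M -expnS -natz natrX.
Qed.

(** Descent: an even solution can be halved, which lowers the exponent by 2 and keeps it odd. Below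
    t all solutions are even by minimality, so the descent would reach x^2 + p y^2 = 2, which has no
    solution. *)
Lemma tp_solution_odd (a b : int) :
  a ^+ 2 + p%:Z * b ^+ 2 = 2 ^+ t.+2 -> ~~ (2 %| a)%Z.
Proof.
have parity s (x y : int) : x ^+ 2 + p%:Z * y ^+ 2 = 2 ^+ s.+2 -> (2 %| x)%Z ->
    exists x' y' : int, x = 2 * x' /\ x' ^+ 2 + p%:Z * y' ^+ 2 = 2 ^+ s.
  move=> E /dvdzP[x' Dx]; have : (2 %| p%:Z * y ^+ 2)%Z.
    have : (2 %| x ^+ 2 + p%:Z * y ^+ 2)%Z by rewrite E exprS dvdz_mulr.
    by rewrite rpredDl //; rewrite Dx expr2; exact/dvdz_mull/dvdz_mull.
  rewrite !dvdzE abszM abszX Euclid_dvdM // Euclid_dvdX // andbT absz_nat.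
  rewrite {1}dvdn2 p_odd /= => y2; have /dvdzP[y' Dy] : (2 %| y)%Z by [].
  exists x', y'; split; first by rewrite Dx mulrC.
  have E4 : 2 ^+ s.+2 = 4 * 2 ^+ s :> int by rewrite !exprS; ring.
  by apply: (@mulfI _ 4) => //; rewrite -E4 -E Dx Dy; ring.
have no2 (x y : int) : x ^+ 2 + p%:Z * y ^+ 2 <> 2.
  move=> E; have := sqr_ge0 x; have [y0|y0] := eqVneq y 0.
    by move: E; rewrite y0 expr0n mulr0 addr0 => /sqr_neq2.
  have : 1 <= y ^+ 2 by rewrite -gtz0_ge1 lt_neqAle sqr_ge0 eq_sym sqrf_eq0 y0.
  by move: p_ge7; nia.
have main s : odd s -> (s <= t)%N -> forall x y : int,
    x ^+ 2 + p%:Z * y ^+ 2 = 2 ^+ s.+2 -> s = t /\ ~~ (2 %| x)%Z.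
  elim/ltn_ind: s => s IH s_odd le_s x y E.
  have [x_even|x_odd] := boolP (2 %| x)%Z; last first.
    split=> //; apply/eqP; rewrite eqn_leq le_s leqNgt; apply: contra x_odd => lt_s.
    by apply: tp_no_smaller_solution E; rewrite lt_s andbT; case: (s) s_odd.
  have [x' [y' [_ E']]] := parity _ _ _ E x_even.
  case: s s_odd le_s IH E E' => [//|[|s]] s_odd le_s IH E E'.
    by case: (no2 x' y'); rewrite E' expr1.
  have [] // := IH s _ _ _ x' y' E'; rewrite ?ltnS //; first by move: s_odd; lia.
    by lia.
  by move=> st; lia.
by move=> E; case: (main t tp_odd (leqnn t) a b E).
Qed.

(** The numbers ab' - a'b and ab' + a'b have product 2^(t+2) (b'^2 - b^2) and odd half-sum, so one
    of them is divisible by 2^(t+1). The norm of a product bounds p times its square by 16 * 4^t,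
    while a nonzero value would give at least 28 * 4^t; hence it is 0. *)
Lemma odd_solution_uniq (a b a' b' : int) :
  a ^+ 2 + p%:Z * b ^+ 2 = 2 ^+ t.+2 -> a' ^+ 2 + p%:Z * b' ^+ 2 = 2 ^+ t.+2 ->
  a' ^+ 2 = a ^+ 2 /\ b' ^+ 2 = b ^+ 2.
Proof.
have odd_b (x y : int) : x ^+ 2 + p%:Z * y ^+ 2 = 2 ^+ t.+2 -> ~~ (2 %| x)%Z /\ ~~ (2 %| y)%Z.
  move=> E; have x_odd := tp_solution_odd E; split=> //; apply: contra x_odd => y_even.
  have : (2 %| x ^+ 2)%Z.
    have : (2 %| x ^+ 2 + p%:Z * y ^+ 2)%Z by rewrite E exprS dvdz_mulr.
    by rewrite rpredDr //; rewrite expr2; exact/dvdz_mull/dvdz_mull.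
  by rewrite !dvdzE abszX Euclid_dvdX // andbT.
have main (x y x' y' u : int) : x ^+ 2 + p%:Z * y ^+ 2 = 2 ^+ t.+2 ->
    x' ^+ 2 + p%:Z * y' ^+ 2 = 2 ^+ t.+2 -> x * y' - x' * y = 2 * (2 ^+ t * u) ->
    y' ^+ 2 = y ^+ 2.
  move=> E E' D.
  (* Brahmagupta's identity for the product of one solution with the conjugate of the other. *)
  have N : (x * x' + p%:Z * (y * y')) ^+ 2 + p%:Z * (x * y' - x' * y) ^+ 2 = 2 ^+ t.+2 * 2 ^+ t.+2.
    by rewrite -{1}E -E'; ring.
  have T_gt0 : 0 < (2 ^+ t : int) by rewrite exprn_gt0.
  have u0 : u = 0.
    apply/eqP; apply: contraT => u_neq0.
    have u2 : 1 <= u ^+ 2 by rewrite -gtz0_ge1 lt_neqAle sqr_ge0 eq_sym sqrf_eq0 u_neq0.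
    have E16 : 2 ^+ t.+2 * 2 ^+ t.+2 = 16 * (2 ^+ t) ^+ 2 :> int by rewrite !exprS; ring.
    have : p%:Z * (x * y' - x' * y) ^+ 2 <= 16 * (2 ^+ t) ^+ 2.
      by rewrite -E16 -N lerDr sqr_ge0.
    have -> : p%:Z * (x * y' - x' * y) ^+ 2 = 4 * (p%:Z * u ^+ 2) * (2 ^+ t) ^+ 2.
      by rewrite D; ring.
    rewrite ler_pM2r ?exprn_gt0 //; have : 7 * 1 <= p%:Z * u ^+ 2.
      by apply: ler_pM => //; rewrite lez_nat.
    by move: (p%:Z * u ^+ 2) => v; clear; lia.
  have Z : (x * y' - x' * y) * (x * y' + x' * y) = 2 ^+ t.+2 * (y' ^+ 2 - y ^+ 2).
    by rewrite mulrBr -{1}E -E'; ring.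
  move/eqP: Z; rewrite D u0 !mulr0 mul0r eq_sym mulf_eq0 expf_eq0 /= subr_eq0.
  by move/eqP.
move=> E E'; suff Eb : b' ^+ 2 = b ^+ 2.
  by split=> //; move: E E'; rewrite Eb => <- /addIr.
have [a_odd b_odd] := odd_b _ _ E; have [a'_odd b'_odd] := odd_b _ _ E'.
have dvd2M (x y : int) : (2 %| x * y)%Z = (2 %| x)%Z || (2 %| y)%Z.
  by rewrite !dvdzE abszM Euclid_dvdM.
have o1 : ~~ (2 %| a * b')%Z by rewrite dvd2M negb_or a_odd.
have o2 : ~~ (2 %| a' * b)%Z by rewrite dvd2M negb_or a'_odd.
have [x Dx] : exists x, a * b' - a' * b = 2 * x.
  by exists ((a * b' - a' * b) %/ 2)%Z; clear -o1 o2; lia.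
have [y Dy] : exists y, a * b' + a' * b = 2 * y.
  by exists ((a * b' + a' * b) %/ 2)%Z; clear -o1 o2; lia.
have xy_odd : ~~ (2 %| x + y)%Z.
  by rewrite (_ : x + y = a * b') //; clear -Dx Dy; lia.
have xy : (2 ^+ t %| x * y)%Z.
  apply/dvdzP; exists (b' ^+ 2 - b ^+ 2); apply: (@mulfI _ 4) => //.
  have -> : 4 * (x * y) = (2 * x) * (2 * y) by ring.
  rewrite -Dx -Dy.
  have -> : (a * b' - a' * b) * (a * b' + a' * b) = (a * b') ^+ 2 - (a' * b) ^+ 2 by ring.
  have -> : 4 * ((b' ^+ 2 - b ^+ 2) * 2 ^+ t) = 2 ^+ t.+2 * b' ^+ 2 - 2 ^+ t.+2 * b ^+ 2.
    by rewrite !exprS; ring.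
  by rewrite -{1}E -E'; ring.
have co (n : int) : ~~ (2 %| n)%Z -> coprimez (2 ^+ t) n.
  move=> n_odd; rewrite coprimezXl // coprimezE coprime2n.
  by move: n_odd; rewrite dvdzE dvdn2 negbK.
have [x_even|x_odd] := boolP (2 %| x)%Z.
  have y_odd : ~~ (2 %| y)%Z by clear -x_even xy_odd; lia.
  move: xy; rewrite Gauss_dvdzl ?co // => /dvdzP[u Du].
  by apply: (main a b a' b' u) => //; rewrite Dx Du [2 ^+ t * u]mulrC.
move: xy; rewrite Gauss_dvdzr ?co // => /dvdzP[u Du].
(* Changing the sign of b exchanges the two factors. *)
rewrite -[b ^+ 2]sqrrN; apply: (main a (- b) a' b' u); rewrite ?sqrrN //.
by rewrite mulrN opprK Dy Du [2 ^+ t * u]mulrC.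
Qed.

End MinimalExponent.

(** * Congruences modulo 2 *)

(** An explicit cofactor showing that y - 1 divides n; for n odd this inverts y - 1 modulo 2. *)
Lemma unity_root_sub1_dvd (R : comNzRingType) n (y : R) : y ^+ n = 1 -> \sum_(k < n) y ^+ k = 0 ->
  (y - 1) * \sum_(k < n) k%:R * y ^+ k = n%:R.
Proof.
move=> yn s0.
have E j : (y - 1) * \sum_(k < j) k%:R * y ^+ k = j%:R * y ^+ j - y * \sum_(k < j) y ^+ k.
  elim: j => [|j IH]; first by rewrite !big_ord0 !mulr0 mul0r subrr.
  by rewrite !big_ord_recr /= mulrDr IH -natr1 exprS; ring.
by rewrite E yn s0 mulr0 subr0 mulr1.
Qed.

Section Congruence.
Variables (C : numClosedFieldType) (p e d t : nat) (z : C).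
Hypotheses (p_pr : prime p) (p_mod8 : (p = 7 %[mod 8])%N).
Let m := (p ^ e.+1)%N.
Hypothesis prim_z : m.-primitive_root z.
Hypotheses (d_odd : odd d) (ord2 : (2 ^ d = 1 %[mod m])%N).
Hypothesis gen2 : forall k, coprime k m ->
  exists i, (k = 2 ^ i %[mod m])%N \/ (k = m.-1 * 2 ^ i %[mod m])%N.
Hypothesis tp : is_tp p t.

Let p_mod4 : (p = 3 %[mod 4])%N. Proof. by move: p_mod8; lia. Qed.
Let m_odd : odd m. Proof. by rewrite oddX orbC; move: p_mod8; lia. Qed.
Let m_gt0 : (0 < m)%N := prim_order_gt0 prim_z.
Let zm : z ^+ m = 1. Proof. exact: prim_expr_order. Qed.
Let z_neq0 : z != 0. Proof. by rewrite (prim_root_eq0 prim_z) -lt0n. Qed.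

(** The value a/2 is rational, hence the same at all conjugates, and a rational element of Z[z] is
    an integer. *)
Lemma odd_int_not_double (a : int) (Q : {poly int}) : a%:~R = 2 * zeval z Q -> (2 %| a)%Z.
Proof.
move=> E; have [k co|c Dc] := zeval_fixed_int prim_z (Q := Q) (v := zeval z Q).
  apply: (@mulfI _ (2 : C)); first by rewrite pnatr_eq0.
  have := zeval_galois_eq prim_z (P := a%:P) (Q := 2 * Q) co.
  by rewrite !rmorphM /= !rmorph_nat !zevalC -E; move/(_ erefl).
apply/dvdzP; exists c; apply: (@intr_inj C).
by rewrite E Dc mulrC -[2 in LHS]/(2%:~R) -rmorphM.
Qed.

Lemma congruent_norm_sign (P Q R : {poly int}) : Q = P + 2 * R ->
  zeval z P * (zeval z P)^* = 2 ^+ t -> zeval z Q * (zeval z Q)^* = 2 ^+ t ->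
  zeval z Q = zeval z P \/ zeval z Q = - zeval z P.
Proof.
move=> DQ normP normQ; have [t_gt0 _] := tp.
have [j [a [b [Nab DP]]]] := quadratic_descent p_pr p_mod4 prim_z d_odd ord2 gen2 normP.
have [j' [a' [b' [Nab' DQ']]]] := quadratic_descent p_pr p_mod4 prim_z d_odd ord2 gen2 normQ.
have a_odd := tp_solution_odd p_pr p_mod8 tp Nab.
have [Ea Eb] := odd_solution_uniq p_pr p_mod8 tp Nab Nab'.
set G := gauss_sum p (z ^+ (p ^ e)) in DP DQ'.
have two0 : 2 != 0 :> C by rewrite pnatr_eq0.
have zjV i : z ^+ i * z ^+ (m.-1 * i) = 1.
  by rewrite -exprD -mulSn prednK // exprM zm expr1n.
pose Gam := P * 'X^(m.-1 * j); pose g := zeval z Gam.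
have zg : zeval z P * z ^+ (m.-1 * j) = g by rewrite /g rmorphM /= zevalXn.
have DPg : zeval z P = z ^+ j * g by rewrite /g rmorphM /= zevalXn mulrCA zjV mulr1.
have Dg : 2 * g = a%:~R + b%:~R * G.
  rewrite /g rmorphM /= zevalXn mulrA DP mulrC mulrA [_ * z ^+ j]mulrC zjV mul1r //.
have conjz : (zeval z Gam)^* = zeval z (Gam \Po 'X^(m.-1)).
  by have := zeval_compX_pred p_pr prim_z 1 Gam; rewrite expr1.
have Dgc : 2 * g^* = a%:~R - b%:~R * G.
  have prim_w : p.-primitive_root (z ^+ (p ^ e)).
    have := @dvdn_prim_root _ _ _ prim_z p; rewrite /m expnS dvdn_mulr // => /(_ isT).
    by rewrite mulKn ?prime_gt0.
  have : (2 * g)^* = (a%:~R + b%:~R * G)^* by rewrite Dg.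
  rewrite [LHS]rmorphM [RHS]rmorphD /= conjC_nat [in RHS]rmorphM /= !rmorph_int.
  by rewrite (gauss_sum_conj p_pr p_mod4 prim_w) mulrN.
have gDgc : g + g^* = a%:~R.
  by apply: (mulfI two0); rewrite mulrDr Dg Dgc; ring.
have ggc : g * g^* = 2 ^+ t.
  rewrite -normP DPg rmorphM /= mulrACA.
  have -> : z ^+ j * (z ^+ j)^* = 1.
    rewrite (@conj_unity_root _ m) ?divff ?expf_neq0 //.
    by rewrite exprAC zm expr1n.
  by rewrite mul1r.
have DQR : zeval z Q = z ^+ j * g + 2 * zeval z R.
  by rewrite -DPg DQ rmorphD rmorphM /= rmorph_nat.
have sq (x y : int) : x ^+ 2 = y ^+ 2 -> exists s : bool, x = (-1) ^+ s * y.
  move/eqP; rewrite eqf_sqr => /orP[]/eqP->; [exists false | exists true].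
    by rewrite mul1r.
  by rewrite mulN1r.
have [s Ds] : exists s : bool, zeval z Q = (-1) ^+ s * z ^+ j' * g \/
                       zeval z Q = (-1) ^+ s * z ^+ j' * g^*.
  have [sa Da] := sq _ _ Ea; have [sb Db] := sq _ _ Eb.
  exists sa; have [Es|Es] := eqVneq sa sb; [left | right];
    apply: (mulfI two0); rewrite DQ' mulrCA ?Dg ?Dgc Da Db !rmorphM !rmorphXn !rmorphN rmorph1 /=.
    by rewrite -Es; ring.
  by case: (sa) (sb) Es => -[] // _; ring.
have not2g (S : {poly int}) : g = 2 * zeval z S -> False.
  move=> E; case/negP: a_odd; apply: (@odd_int_not_double _ (S + (S \Po 'X^(m.-1)))).
  have := zeval_compX_pred p_pr prim_z 1 S; rewrite expr1 rmorphD /= => ->.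
  by rewrite -gDgc E rmorphM /= conjC_nat; ring.
case: Ds => Ds.
  have [Ez|ne] := eqVneq (z ^+ j') (z ^+ j).
    by rewrite Ds Ez -mulrA -DPg; case: (s); [right; rewrite mulN1r | left; rewrite mul1r].
  exfalso; pose y := z ^+ (j' + m.-1 * j).
  have Dy : z ^+ j' = z ^+ j * y by rewrite /y exprD mulrCA zjV mulr1.
  have y1 : y != 1 by apply: contra ne => /eqP y1; rewrite Dy y1 mulr1.
  have ym : y ^+ m = 1 by rewrite /y exprAC zm expr1n.
  have sumy := sum_unity_root ym y1.
  have DmY := unity_root_sub1_dvd ym sumy.
  pose Y : {poly int} := \sum_(k < m) k%:R * 'X^(j' + m.-1 * j) ^+ k.
  have DY : zeval z Y = \sum_(k < m) k%:R * y ^+ k.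
    rewrite rmorph_sum; apply: eq_bigr => k _.
    by rewrite rmorphM rmorph_nat rmorphXn /= zevalXn.
  have [S DS] : exists S, (y - 1) * g = 2 * zeval z S.
    (* The congruence gives (-1)^s y g = g + 2 R z^(-j); the second summand absorbs 2 y g when the
       sign is negative. *)
    exists (R * 'X^(m.-1 * j) + s%:R * ('X^(j' + m.-1 * j) * Gam)).
    rewrite rmorphD !rmorphM /= rmorph_nat !zevalXn -/y zg.
    have E : (-1) ^+ s * y * g = g + 2 * (zeval z R * z ^+ (m.-1 * j)).
      apply: (mulfI (expf_neq0 j z_neq0)).
      have -> : z ^+ j * ((-1) ^+ s * y * g) = (-1) ^+ s * z ^+ j' * g by rewrite Dy; ring.
      rewrite -Ds DQR mulrDr; congr (_ + _).
      by rewrite -[zeval z R in LHS]mulr1 -(zjV j); ring.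
    have E' : 2 * (zeval z R * z ^+ (m.-1 * j)) = (-1) ^+ s * y * g - g.
      by rewrite E; ring.
    by rewrite mulrDr E'; case: (s) => /=; rewrite ?expr1 ?expr0; ring.
  (* Multiplying by the cofactor of y - 1 makes m g a double; since m = 1 + 2n, so is g. *)
  pose n := (m./2)%N.
  apply: (@not2g (Y * S - n%:R * Gam)).
  have Dm : m%:R = 1 + 2 * n%:R :> C.
    by rewrite -[m]odd_double_half m_odd natrD -muln2 natrM mulrC.
  have : m%:R * g = 2 * (zeval z Y * zeval z S).
    by rewrite -DmY mulrAC DS DY; ring.
  rewrite Dm rmorphB !rmorphM /= rmorph_nat zevalXn zg => E.
  by rewrite mulrBr -E; ring.
exfalso; have monomial i : exists T : {poly int}, zeval z T = z ^+ i.
  by exists 'X^i; exact: zevalXn.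
have [T DT] := monomial (j' + m.-1 * j)%N; have [U DU] := monomial (m.-1 * j)%N.
have [S DS] : exists S, g ^+ 2 = 2 * zeval z S.
  (* Multiplying the congruence by g turns the conjugate term into a multiple of g conj g = 2^t,
     with t positive. Then a^2, the square of g + conj g, is even. *)
  exists ((-1) ^+ s * T * 2 ^+ t.-1 - R * U * Gam).
  have E : (-1) ^+ s * zeval z T * g^* = g + 2 * (zeval z R * z ^+ (m.-1 * j)).
    apply: (mulfI (expf_neq0 j z_neq0)).
    have -> : z ^+ j * ((-1) ^+ s * zeval z T * g^*) = (-1) ^+ s * z ^+ j' * g^*.
      by rewrite DT exprD -[z ^+ j' in RHS]mulr1 -(zjV j); ring.
    rewrite -Ds DQR mulrDr; congr (_ + _).
    by rewrite -[zeval z R in LHS]mulr1 -(zjV j); ring.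
  have -> : zeval z ((-1) ^+ s * T * 2 ^+ t.-1 - R * U * Gam) =
      (-1) ^+ s * zeval z T * 2 ^+ t.-1 - zeval z R * z ^+ (m.-1 * j) * g.
    rewrite -DU /g; move: (Gam) => H.
    by rewrite rmorphB !rmorphM /= !rmorphXn rmorphN rmorph1 /= rmorph_nat.
  have E2 : 2 * 2 ^+ t.-1 = g * g^* by rewrite -exprS prednK.
  have E3 : g * ((-1) ^+ s * zeval z T * g^*) = g * (g + 2 * (zeval z R * z ^+ (m.-1 * j))).
    by rewrite E.
  have -> : g ^+ 2 = g * (g + 2 * (zeval z R * z ^+ (m.-1 * j)))
     - 2 * (zeval z R * z ^+ (m.-1 * j)) * g by ring.
  by rewrite -E3 mulrBr [2 * (_ * 2 ^+ _)]mulrCA E2; ring.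
have : (2 %| a ^+ 2)%Z.
  apply: (@odd_int_not_double _ (S + (S \Po 'X^(m.-1)) + 2 ^+ t)).
  have Sc := zeval_compX_pred p_pr prim_z 1 S; rewrite expr1 in Sc.
  have D2t : zeval z (2 ^+ t) = 2 ^+ t by rewrite rmorphXn /= rmorph_nat.
  rewrite rmorphD /= D2t rmorphD /= Sc.
  have : (g^*) ^+ 2 = 2 * (zeval z S)^*.
    by rewrite -rmorphXn DS rmorphM /= conjC_nat.
  rewrite rmorphXn /= -gDgc -ggc => Ec; rewrite !mulrDr -Ec -DS; ring.
by rewrite dvdzE abszX Euclid_dvdX // andbT -dvdzE; apply/negP.
Qed.
End Congruence.

(** * Walsh transforms *)

Lemma cis_exp (R : realType) (a : R) k :
  Complex (trigo.cos a) (trigo.sin a) ^+ k =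
  Complex (trigo.cos (k%:R * a)) (trigo.sin (k%:R * a)).
Proof.
elim: k => [|k IH]; first by rewrite expr0 mul0r trigo.cos0 trigo.sin0.
rewrite exprS IH -[k.+1]add1n natrD mulrDl mul1r trigo.cosD trigo.sinD.
by congr Complex; rewrite addrC.
Qed.

(** If the order k were smaller than n, then y = k pi / n lies strictly between 0 and pi, so cos(2y)
    = 1 - 2 sin(y)^2 < 1. *)
Lemma cis_prim_root (R : realType) n : (0 < n)%N ->
  n.-primitive_root (Complex (trigo.cos (2 * pi / n%:R : R)) (trigo.sin (2 * pi / n%:R))).
Proof.
move=> n_gt0; set w := Complex _ _; have n0 : n%:R != 0 :> R by rewrite pnatr_eq0 -lt0n.
have wn : w ^+ n = 1.
  by rewrite cis_exp mulrC divfK // mulr_natl cos2pi sin2pi.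
have [k prim_k k_dv] := prim_order_exists n_gt0 wn.
have k_gt0 := prim_order_gt0 prim_k.
have [lt_kn|le_nk] := ltnP k n; last first.
  by rewrite (_ : n = k) //; apply/eqP; rewrite eqn_leq le_nk dvdn_leq.
have := prim_expr_order prim_k; rewrite cis_exp => -[+ _].
pose y : R := k%:R * (pi / n%:R).
have -> : k%:R * (2 * pi / n%:R) = y *+ 2 by rewrite /y mulr2n; ring.
have siny : 0 < trigo.sin y.
  apply: sin_gt0_pi; rewrite mulr_gt0 ?divr_gt0 ?pi_gt0 ?ltr0n //=.
  by rewrite /y mulrCA gtr_pMr ?pi_gt0 // ltr_pdivrMr ?ltr0n // mul1r ltr_nat.
have := sin2cos2 y; have : 0 < trigo.sin y ^+ 2 by rewrite exprn_gt0.
rewrite cos_mulr2n; move: (trigo.sin y ^+ 2) (trigo.cos y ^+ 2) => S K; lra.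
Qed.

Lemma zeta_prim n : (0 < n)%N -> n.-primitive_root (zeta n).
Proof. exact: cis_prim_root. Qed.

Lemma signF2D (R : pzRingType) (a b : 'F_2) :
  (-1) ^+ ((a + b)%R : nat) = (-1) ^+ a * (-1) ^+ b :> R.
Proof.
by case: a => [[|[|//]] ?]; case: b => [[|[|//]] ?];
  rewrite /= ?expr0 ?expr1 ?mulr1 ?mul1r ?mulrNN ?mulr1.
Qed.

Lemma sum_sign_dot (R : numDomainType) n (x : 'rV['F_2]_n) :
  \sum_(l : 'rV['F_2]_n) (-1) ^+ (dotF2 x l : nat) = (if x == 0 then 2 ^+ n else 0) :> R.
Proof.
have [->|x_neq0] := eqVneq x 0.
  rewrite (eq_bigr (fun=> 1)) => [|l _]; last by rewrite /dotF2 mul0mx mxE.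
  by rewrite sumr_const cardT -cardE card_mx card_Fp // mul1n natrX.
have [i xi] : exists i, x 0 i = 1.
  have [i xi] : exists i, x 0 i != 0.
    apply/existsP; apply: contraNT x_neq0 => /existsPn x0.
    by apply/eqP/rowP => i; rewrite mxE; apply/eqP; have := x0 i; rewrite negbK.
  by exists i; case: (x 0 i) xi => [[|[|//]] ?] // _; exact: val_inj.
set S := \sum_l _; suff : S = - S by move/eqP; rewrite eq_sym eqNr => /eqP.
(* Translating l by the i-th basis vector, where x has coordinate 1, flips every sign. *)
rewrite {1}/S (reindex_inj (addIr (delta_mx (0 : 'I_1) i))) /= -sumrN.
apply: eq_bigr => l _; rewrite /dotF2 linearD /= mulmxDr mxE signF2D.
have -> : (x *m (delta_mx (0 : 'I_1) i)^T) 0 0 = 1.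
  rewrite mxE (bigD1 i) //= big1 => [|j /negbTE ne]; rewrite !mxE !eqxx /=.
    by rewrite xi mulr1 addr0.
  by rewrite ne mulr0.
by rewrite mulrN1.
Qed.

Lemma gbent_norm n m (f : 'rV['F_2]_n -> 'Z_m) l : gbent f ->
  gwalsh f l * (gwalsh f l)^* = 2 ^+ n.
Proof.
move=> bent; rewrite -normCK (bent l) -rmorphXn sqr_sqrtr ?exprn_ge0 //.
by rewrite rmorphXn rmorph_nat.
Qed.

Lemma sum_gwalsh n m (f : 'rV['F_2]_n -> 'Z_m) :
  \sum_l gwalsh f l = 2 ^+ n * zeta m ^+ (f 0 : nat).
Proof.
have E x : \sum_l zeta m ^+ (f x : nat) * (-1) ^+ (dotF2 x l : nat) =
    zeta m ^+ (f x : nat) * (if x == 0 then 2 ^+ n else 0).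
  by rewrite -mulr_sumr sum_sign_dot.
rewrite exchange_big (eq_bigr _ (fun x _ => E x)) (bigD1 0) //= eqxx mulrC.
by rewrite big1 ?addr0 // => x /negbTE ->; rewrite mulr0.
Qed.

Lemma sign_double (R : pzRingType) k : (-1) ^+ k = 1 + 2 * - (odd k)%:R :> R.
Proof.
rewrite -signr_odd; case: odd => /=; last by rewrite oppr0 mulr0 addr0.
by rewrite mulrN1 mulr2n opprD addrA subrr add0r.
Qed.

(** Exponents are shifted, m = p^(e+1), so that the disjunction covers both claims: e = 0, or any e
    under the condition modulo p^2. *)
Lemma no_gbent p t e : prime p -> (p = 7 %[mod 8])%N ->
  mult_order_mod 2 p (p.-1./2) -> is_tp p t ->
  e = 0%N \/ (2 ^ p.-1 <> 1 %[mod p ^ 2])%N ->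
  forall f : 'rV['F_2]_t -> 'Z_(2 * p ^ e.+1), ~ gbent f.
Proof.
move=> p_pr p_mod8 ord2p tp wief f bent.
have p_odd : odd p by clear -p_mod8; lia.
have h_odd : odd p.-1./2 by clear -p_mod8; lia.
set m := (p ^ e.+1)%N in f bent.
have m_gt0 : (0 < m)%N by rewrite expn_gt0 prime_gt0.
have m_odd : odd m by rewrite oddX p_odd orbT.
pose v : CC := zeta (2 * m); pose z : CC := v ^+ 2.
have prim_v : (2 * m).-primitive_root v by apply: zeta_prim; rewrite muln_gt0.
have prim_z : m.-primitive_root z.
  by have := dvdn_prim_root prim_v (dvdn_mull 2 (dvdnn m)); rewrite mulnK.
have vm : v ^+ m = -1.
  have : (v ^+ m) ^+ 2 == 1 by rewrite -exprM mulnC prim_expr_order.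
  rewrite sqrf_eq1 -(prim_order_dvd prim_v) => /orP[|/eqP//].
  by move/(dvdn_leq m_gt0); rewrite -{2}[m]mul1n leq_pmul2r.
(* From v^m = -1 follows v = -v^(m+1) = -z^h, which brings the powers of the 2m-th root v into
   Z[z]. *)
pose h := (m.+1)./2.
have vE : v = - z ^+ h.
  have -> : z ^+ h = v ^+ m.+1.
    by rewrite -exprM mul2n /h -[in RHS](odd_double_half m.+1) /= m_odd.
  by rewrite exprS vm mulrN1 opprK.
have vX k : v ^+ k = (-1) ^+ k * z ^+ (h * k) .
  by rewrite [in LHS]vE [LHS]exprNn exprM.
pose P l : {poly int} := \sum_(x : 'rV['F_2]_t)
  (-1) ^+ (f x : nat) * 'X^(h * (f x : nat)) * (-1) ^+ (dotF2 x l : nat).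
have PE l : zeval z (P l) = gwalsh f l.
  rewrite rmorph_sum; apply: eq_bigr => x _; rewrite -[zeta _]/v vX.
  by rewrite !rmorphM /= zevalXn !rmorphXn rmorphN rmorph1.
have norm_P l : zeval z (P l) * (zeval z (P l))^* = 2 ^+ t.
  by rewrite PE; exact: gbent_norm.
have cong l : exists R, P l = P 0 + 2 * R.
  exists (\sum_x (-1) ^+ (f x : nat) * 'X^(h * (f x : nat)) * - (odd (dotF2 x l))%:R).
  rewrite mulr_sumr -big_split /=; apply: eq_bigr => x _.
  have -> : dotF2 x 0 = 0 by rewrite /dotF2 linear0 mulmx0 mxE.
  by rewrite expr0 mulr1 [(-1) ^+ dotF2 x l]sign_double mulrDr mulr1 mulrCA.
have sgn l : zeval z (P l) = (-1) ^+ (zeval z (P l) != zeval z (P 0)) * zeval z (P 0).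
  have [->|ne] := eqVneq (zeval z (P l)) (zeval z (P 0)); first by rewrite mul1r.
  rewrite mulN1r; have [R DR] := cong l.
  have := congruent_norm_sign p_pr p_mod8 prim_z (two_order_odd p_odd e h_odd)
    (two_exp_order p_pr p_odd e ord2p) (units_pm_two p_pr p_odd h_odd ord2p wief)
    tp DR (norm_P 0) (norm_P l).
  by case=> [E|->]; [rewrite E eqxx in ne|].
(* The signed count of the l with F(l) = F(0) or -F(0); taking squared moduli in the sum formula
   gives N^2 2^t = 4^t. *)
pose N : int := \sum_l (-1) ^+ (zeval z (P l) != zeval z (P 0)).
have NE : N%:~R * zeval z (P 0) = 2 ^+ t * v ^+ (f 0 : nat).
  rewrite -sum_gwalsh rmorph_sum mulr_suml; apply: eq_bigr => l _.
  by rewrite -PE [RHS]sgn rmorphXn rmorphN rmorph1.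
have N2 : N ^+ 2 = 2 ^+ t.
  apply: (@intr_inj CC); apply: (@mulfI _ (2 ^+ t : CC)).
    by rewrite expf_neq0 // pnatr_eq0.
  have v1 : v ^+ (f 0 : nat) * (v ^+ (f 0 : nat))^* = 1.
    have vv := prim_expr_order prim_v.
    rewrite (@conj_unity_root _ (2 * m)) ?muln_gt0 // ?divff //.
      by rewrite expf_neq0 // (prim_root_eq0 prim_v) -lt0n muln_gt0.
    by rewrite exprAC vv expr1n.
  have : N%:~R * zeval z (P 0) * (N%:~R * zeval z (P 0))^* = 2 ^+ t * 2 ^+ t.
    by rewrite NE rmorphM /= mulrACA v1 mulr1 rmorphXn /= conjC_nat.
  rewrite rmorphM /= mulrACA norm_P rmorph_int => E.
  by rewrite !rmorphXn /= rmorph_nat -E; ring.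
have := tp_odd p_pr p_mod8 tp.
have : (`|N| ^ 2 = 2 ^ t)%N by rewrite -abszX N2 abszX.
move/(congr1 (logn 2)); rewrite lognX pfactorK // => <-.
by rewrite oddM.
Qed.

Local Close Scope ring_scope.

Theorem theorem2 (p t : nat) :
  prime p -> p = 7 %[mod 8] -> mult_order_mod 2 p (p.-1./2) -> is_tp p t ->
  (forall f : 'rV['F_2]_t -> 'Z_(2 * p), ~ gbent f) /\
  (2 ^ p.-1 <> 1 %[mod p ^ 2] ->
   forall e : nat, 0 < e -> forall f : 'rV['F_2]_t -> 'Z_(2 * p ^ e), ~ gbent f).
Proof.
move=> p_pr p_mod8 ord2 tp; split.
  exact: (no_gbent (e := 0) p_pr p_mod8 ord2 tp (or_introl _ erefl)).
by move=> wief [//|e] _; apply: no_gbent => //; right.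
Qed.
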